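(* Let $v,a,b,c\in\mathbb{C}$ with $a\neq0$, $b\neq0$, $v\neq 1$, $\Re(v)<3$, $\Re(c)>0$, and $\Re(vc+a+b)>0$, $\Re(vc+a-b)>0$, $\Re(vc-a+b)>0$, $\Re(vc-a-b)>0$. Put $\sigma_3=\frac v2-\frac{a}{2c}-\frac{b}{2c}$, $\sigma_4=\frac v2-\frac{a}{2c}+\frac{b}{2c}$, $\sigma_5=\frac v2+\frac{a}{2c}+\frac{b}{2c}$, $\sigma_6=\frac v2+\frac{a}{2c}-\frac{b}{2c}$, and $P=(vc-a-b)(vc+a+b)(vc-a+b)(vc+a-b)$. Assume $\frac v2\notin\mathbb{Z}_0^-$ and $1+\sigma_j\notin\mathbb{Z}_0^-$ for $j=3,4,5,6$. Then $$ {}_6F_5\!\left(\begin{matrix}v,\ 1+\frac v2,\ \sigma_3,\ \sigma_5,\ \sigma_4,\ \sigma_6\\ \frac v2,\ 1+\sigma_3,\ 1+\sigma_5,\ 1+\sigma_4,\ 1+\sigma_6\end{matrix};\,1\right) =\frac{P}{16\,v\,a\,b\,c^{2}\,\Gamma(v)}\left[\Gamma(\sigma_5)\Gamma(\sigma_3)\frac{\cos\!\big(\frac{(a+b)\pi}{2c}\big)}{\cos(\frac{v\pi}{2})}-\Gamma(\sigma_6)\Gamma(\sigma_4)\frac{\cos\!\big(\frac{(a-b)\pi}{2c}\big)}{\cos(\frac{v\pi}{2})}\right]. $$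
   Context: $\mathbb{Z}_0^-=\{0,-1,-2,\dots\}$. The Pochhammer symbol is $(\lambda)_0=1$, $(\lambda)_n=\lambda(\lambda+1)\cdots(\lambda+n-1)$ for $n\ge1$. The generalized hypergeometric series is ${}_pF_q\!\left(\begin{matrix}\alpha_1,\dots,\alpha_p\\ \beta_1,\dots,\beta_q\end{matrix};z\right)=\sum_{n=0}^\infty\frac{(\alpha_1)_n\cdots(\alpha_p)_n}{(\beta_1)_n\cdots(\beta_q)_n}\frac{z^n}{n!}$ (with no $\beta_j\in\mathbb{Z}_0^-$); when $p=q+1$ and $z=1$ it converges if $\Re(\sum\beta_j-\sum\alpha_i)>0$. $\Gamma$ is Euler's gamma function. *)

(* Defs.v *)
From Stdlib Require Import Reals Arith ClassicalEpsilon.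
Open Scope R_scope.

Record Cx : Type := mkC { Re : R ; Im : R }.

Definition RtoC (x : R) : Cx := mkC x 0.
Definition Czero : Cx := RtoC 0.
Definition Cone : Cx := RtoC 1.
Definition Ci : Cx := mkC 0 1.
Definition Cadd (z w : Cx) : Cx := mkC (Re z + Re w) (Im z + Im w).
Definition Copp (z : Cx) : Cx := mkC (- Re z) (- Im z).
Definition Csub (z w : Cx) : Cx := Cadd z (Copp w).
Definition Cmul (z w : Cx) : Cx :=
  mkC (Re z * Re w - Im z * Im w) (Re z * Im w + Im z * Re w).
Definition Cinv (z : Cx) : Cx :=
  mkC (Re z / (Re z ^ 2 + Im z ^ 2)) (- Im z / (Re z ^ 2 + Im z ^ 2)).
Definition Cdiv (z w : Cx) : Cx := Cmul z (Cinv w).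
Definition Cnorm (z : Cx) : R := sqrt (Re z ^ 2 + Im z ^ 2).

Definition Cexp (z : Cx) : Cx := mkC (exp (Re z) * cos (Im z)) (exp (Re z) * sin (Im z)).
Definition Ccos (z : Cx) : Cx :=
  Cdiv (Cadd (Cexp (Cmul Ci z)) (Cexp (Copp (Cmul Ci z)))) (RtoC 2).

Definition Cnpow (n : nat) (z : Cx) : Cx := Cexp (Cmul z (RtoC (ln (INR n)))).

Fixpoint Cpow (z : Cx) (n : nat) : Cx :=
  match n with O => Cone | S m => Cmul (Cpow z m) z end.

Definition Cseq_cv (u : nat -> Cx) (l : Cx) : Prop :=
  forall eps : R, eps > 0 -> exists N : nat, forall n : nat, (n >= N)%nat ->
    Cnorm (Csub (u n) l) < eps.

Fixpoint poch (l : Cx) (n : nat) : Cx :=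
  match n with O => Cone | S m => Cmul (poch l m) (Cadd l (RtoC (INR m))) end.

Definition Cfact (n : nat) : Cx := RtoC (INR (Factorial.fact n)).

Fixpoint poch_prod (ps : list Cx) (n : nat) : Cx :=
  match ps with nil => Cone | cons p q => Cmul (poch p n) (poch_prod q n) end.

Definition hyp_term (alphas betas : list Cx) (z : Cx) (n : nat) : Cx :=
  Cdiv (Cmul (poch_prod alphas n) (Cpow z n)) (Cmul (poch_prod betas n) (Cfact n)).

Fixpoint Csum (f : nat -> Cx) (N : nat) : Cx :=
  match N with O => f O | S m => Cadd (Csum f m) (f (S m)) end.

Definition hyp_series_sum (alphas betas : list Cx) (z s : Cx) : Prop :=
  Cseq_cv (Csum (hyp_term alphas betas z)) s.

(* Euler's Gamma via Gauss' limit: Gamma(z) = lim n! n^z / (z(z+1)...(z+n)) *)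
Definition gauss_seq (z : Cx) (n : nat) : Cx :=
  Cdiv (Cmul (Cfact n) (Cnpow n z)) (poch z (S n)).

Definition CGamma (z : Cx) : Cx :=
  epsilon (inhabits Czero) (fun l => Cseq_cv (gauss_seq z) l).

Definition notZ0neg (z : Cx) : Prop := forall k : nat, z <> RtoC (- INR k).

Definition CPI : Cx := RtoC PI.

(* Main.v *)
(** Write [al = (a+b)/2c] and [be = (a-b)/2c].  The summand is a constant multiple of
    [(v)_n (v+2n) / (n! v)] times [1/((x_n^2-al^2)(x_n^2-be^2))], where [x_n = v/2+n].
    Expand in partial fractions, with respect to [y = z^2], the rational function
    [prod_{k<N+2} ((k+1/2)^2-y) / prod_{n<=N} (x_n^2-y)], which approximates a multiple of
    [cos(pi z) Gamma(v/2-z) Gamma(v/2+z)] by the Euler product of the cosine and Gauss'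
    limit, and subtract its values at [z = al] and [z = be].  Its residues, divided by the
    one for [n = 0], are [(v)_n (v+2n) / (n! v)] times weights tending to [1].  Two more
    factors in the numerator than in the denominator keep these weights bounded for
    [Re v < 3]; the linear polynomial part that this creates is negligible after
    normalisation, being of order [N^(v-3)].  So dominated convergence gives the formula on
    the whole half plane [Re v < 3], [v = 2] included, without analytic continuation. *)
Require Import Defs.
From Stdlib Require Import Reals List.
From Stdlib Require Import ClassicalEpsilon Lra Lia ZArith.
From Coquelicot Require Import Rcomplements Rbar Hierarchy Lim_seq Series Continuity Derive
  RInt RInt_analysis AutoDerive.
Import ListNotations.
Open Scope R_scope.

(** * Complex numbers as a field, norm and limits *)

Declare Scope Cx_scope.
Delimit Scope Cx_scope with Cx.
Bind Scope Cx_scope with Cx.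
Local Infix "+" := Cadd : Cx_scope.
Local Infix "-" := Csub : Cx_scope.
Local Infix "*" := Cmul : Cx_scope.
Local Infix "/" := Cdiv : Cx_scope.
Local Notation "- z" := (Copp z) : Cx_scope.
Local Notation "/ z" := (Cinv z) : Cx_scope.

(** The divisor cos(pi v/2) comes from the normalisation: the node for n = 0 is (v/2)^2, so the
    residue there contains the cosine product at v/2. Subtracting the values at y = al^2 and y' =
    be^2 turns the simple poles of the expansion into the two denominators of the summand, at the
    price of the divisor al^2 - be^2 = ab/c^2. The obstacle is the exchange of limit and sum. The
    residues depend on N, and the quotient of consecutive ones has a denominator N - n + const that
    becomes small near n = N. With equally many factors above and below, this constant would be
    (1-v)/2. One more factor in y, that is, two linear ones in z, makes it (3-v)/2, whose real part
    is positive exactly when Re v < 3. This is also the condition under which n^(v-4), the order of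
    the summand, is absolutely summable. Both limits are reached by elementary means: Gauss'
    sequence is an infinite product whose factors are 1 + O(1/n^2), and the cosine product has an
    explicit remainder given by integrals of powers of the cosine. *)

Lemma Cx_ext (z w : Cx) : Re z = Re w -> Im z = Im w -> z = w.
Proof. destruct z, w; simpl; congruence. Qed.

Lemma Cx_sqr_pos (z : Cx) : z <> Czero -> 0 < Re z ^ 2 + Im z ^ 2.
Proof.
  intros Hz. destruct (Req_dec (Re z) 0) as [H|H]; [|nra].
  destruct (Req_dec (Im z) 0) as [H'|H']; [|nra].
  exfalso; apply Hz, Cx_ext; simpl; assumption.
Qed.

Lemma Cx_field_theory :
  field_theory Czero Cone Cadd Cmul Csub Copp Cdiv Cinv (@eq Cx).
Proof.
  split.
  - split; intros; apply Cx_ext; simpl; ring.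
  - intros H; injection H; lra.
  - reflexivity.
  - intros z Hz. pose proof (Cx_sqr_pos z Hz).
    apply Cx_ext; simpl; field; simpl in *; lra.
Qed.

(** Integer coefficients for the [field] instance: the morphism lets it compute with numerals such
    as [RtoC 2], and completeness lets it discharge their nonvanishing. *)
Definition IZC (z : Z) : Cx := RtoC (IZR z).

Lemma IZC_morph :
  ring_morph Czero Cone Cadd Cmul Csub Copp (@eq Cx)
    0%Z 1%Z Z.add Z.mul Z.sub Z.opp Z.eqb IZC.
Proof.
  split; try reflexivity; intros; unfold IZC;
    rewrite ?plus_IZR, ?minus_IZR, ?mult_IZR, ?opp_IZR;
    try (apply Cx_ext; simpl; ring).
  now rewrite (proj1 (Z.eqb_eq x y)).
Qed.

Lemma IZC_eqb (x y : Z) : IZC x = IZC y -> Z.eqb x y = true.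
Proof. intros H; injection H; intros H'. now apply Z.eqb_eq, eq_IZR. Qed.

Ltac IZC_tac t :=
  match t with
  | Czero => constr:(0%Z)
  | Cone => constr:(1%Z)
  | RtoC (IZR ?z) => match isZcst z with true => z | _ => constr:(InitialRing.NotConstant) end
  | IZC ?z => match isZcst z with true => z | _ => constr:(InitialRing.NotConstant) end
  | _ => constr:(InitialRing.NotConstant)
  end.

Add Field Cx_field : Cx_field_theory
  (completeness IZC_eqb, morphism IZC_morph, constants [IZC_tac]).

Lemma RtoC_add (x y : R) : RtoC (x + y) = (RtoC x + RtoC y)%Cx.
Proof. apply Cx_ext; simpl; ring. Qed.

Lemma RtoC_mul (x y : R) : RtoC (x * y) = (RtoC x * RtoC y)%Cx.
Proof. apply Cx_ext; simpl; ring. Qed.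

Lemma RtoC_opp (x : R) : RtoC (- x) = (- RtoC x)%Cx.
Proof. apply Cx_ext; simpl; ring. Qed.

Lemma RtoC_inj (x y : R) : RtoC x = RtoC y -> x = y.
Proof. intros H; injection H; auto. Qed.

Lemma RtoC_neq0 (x : R) : x <> 0 -> RtoC x <> Czero.
Proof. intros H E; apply H, RtoC_inj, E. Qed.

Lemma RtoC_sub (x y : R) : RtoC (x - y) = (RtoC x - RtoC y)%Cx.
Proof. apply Cx_ext; simpl; ring. Qed.

Lemma RtoC_inv (x : R) : x <> 0 -> RtoC (/ x) = (/ RtoC x)%Cx.
Proof. intros H; apply Cx_ext; simpl; field; lra. Qed.

Lemma RtoC_div (x y : R) : y <> 0 -> RtoC (x / y) = (RtoC x / RtoC y)%Cx.
Proof. intros H; unfold Rdiv; now rewrite RtoC_mul, RtoC_inv. Qed.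

Local Notation INC n := (RtoC (INR n)).

Lemma INC_S (n : nat) : INC (S n) = (INC n + Cone)%Cx.
Proof. rewrite S_INR; apply RtoC_add. Qed.

Lemma INC_S_neq0 (n : nat) : INC (S n) <> Czero.
Proof. apply RtoC_neq0, not_0_INR; lia. Qed.

Lemma Cmul_integral (z w : Cx) : (z * w)%Cx = Czero -> z = Czero \/ w = Czero.
Proof.
  intros H. destruct (excluded_middle_informative (z = Czero)) as [|Hz]; [now left|right].
  transitivity (/ z * (z * w))%Cx; [field; assumption|rewrite H; ring].
Qed.

Lemma Cmul_neq0 (z w : Cx) : z <> Czero -> w <> Czero -> (z * w)%Cx <> Czero.
Proof. intros Hz Hw H; destruct (Cmul_integral _ _ H); auto. Qed.

Lemma Cinv_neq0 (z : Cx) : z <> Czero -> (/ z)%Cx <> Czero.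
Proof.
  intros Hz H. apply (F_1_neq_0 Cx_field_theory).
  transitivity (/ z * z)%Cx; [field; assumption|rewrite H; ring].
Qed.

Lemma Cdiv_neq0 (z w : Cx) : z <> Czero -> w <> Czero -> (z / w)%Cx <> Czero.
Proof. intros; apply Cmul_neq0; auto using Cinv_neq0. Qed.

Lemma Csub_neq0 (z w : Cx) : z <> w -> (z - w)%Cx <> Czero.
Proof.
  intros H E; apply H. transitivity (z - w + w)%Cx; [ring|rewrite E; ring].
Qed.

Lemma Cnorm_ge0 (z : Cx) : 0 <= Cnorm z.
Proof. apply sqrt_pos. Qed.

Lemma Cnorm_sqr (z : Cx) : Cnorm z ^ 2 = Re z ^ 2 + Im z ^ 2.
Proof. unfold Cnorm; rewrite pow2_sqrt; nra. Qed.

Lemma Cnorm_eq (z : Cx) (x : R) : 0 <= x -> Re z ^ 2 + Im z ^ 2 = x ^ 2 -> Cnorm z = x.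
Proof. intros Hx H. unfold Cnorm. rewrite H. now apply sqrt_pow2. Qed.

Lemma Cnorm_mul (z w : Cx) : Cnorm (z * w) = Cnorm z * Cnorm w.
Proof.
  apply Cnorm_eq.
  - apply Rmult_le_pos; apply Cnorm_ge0.
  - rewrite Rpow_mult_distr, !Cnorm_sqr; simpl; ring.
Qed.

Lemma Cnorm_RtoC (x : R) : Cnorm (RtoC x) = Rabs x.
Proof. apply Cnorm_eq; [apply Rabs_pos|simpl Re; simpl Im; rewrite pow2_abs; ring]. Qed.

Lemma Cnorm_opp (z : Cx) : Cnorm (- z) = Cnorm z.
Proof. unfold Cnorm; f_equal; simpl; ring. Qed.

Lemma Cnorm_sub_sym (z w : Cx) : Cnorm (z - w) = Cnorm (w - z).
Proof. rewrite <- (Cnorm_opp (z - w)); f_equal; ring. Qed.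

Lemma Re_le_Cnorm (z : Cx) : Rabs (Re z) <= Cnorm z.
Proof. rewrite <- sqrt_Rsqr_abs. apply sqrt_le_1_alt; unfold Rsqr; nra. Qed.

Lemma Im_le_Cnorm (z : Cx) : Rabs (Im z) <= Cnorm z.
Proof. rewrite <- sqrt_Rsqr_abs. apply sqrt_le_1_alt; unfold Rsqr; nra. Qed.

Lemma Cnorm_le_abs (z : Cx) : Cnorm z <= Rabs (Re z) + Rabs (Im z).
Proof.
  pose proof (Rabs_pos (Re z)). pose proof (Rabs_pos (Im z)).
  rewrite <- (sqrt_pow2 (Rabs (Re z) + Rabs (Im z))) by lra.
  apply sqrt_le_1_alt. rewrite <- (pow2_abs (Re z)), <- (pow2_abs (Im z)). nra.
Qed.

Lemma Cnorm_triang (z w : Cx) : Cnorm (z + w) <= Cnorm z + Cnorm w.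
Proof.
  pose proof (Cnorm_ge0 z). pose proof (Cnorm_ge0 w).
  rewrite <- (sqrt_pow2 (Cnorm z + Cnorm w)) by lra.
  apply sqrt_le_1_alt.
  replace ((Cnorm z + Cnorm w) ^ 2) with (Cnorm z ^ 2 + Cnorm w ^ 2 + 2 * (Cnorm z * Cnorm w)) by ring.
  rewrite !Cnorm_sqr.
  (* Cauchy-Schwarz: the left side is the real part of [z] times the conjugate of [w]. *)
  assert (Re z * Re w + Im z * Im w <= Cnorm z * Cnorm w).
  { apply Rle_trans with (Cnorm (z * mkC (Re w) (- Im w))).
    - eapply Rle_trans; [|apply Re_le_Cnorm]. eapply Rle_trans; [|apply Rle_abs]. simpl; lra.
    - rewrite Cnorm_mul. apply Req_le. f_equal. unfold Cnorm; f_equal; simpl; ring. }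
  simpl. nra.
Qed.

Lemma Cnorm_triang_inv (z w : Cx) : Cnorm z - Cnorm w <= Cnorm (z - w).
Proof.
  pose proof (Cnorm_triang (z - w) w) as H.
  replace (z - w + w)%Cx with z in H by ring. lra.
Qed.

Lemma Cnorm_sub_le (z w : Cx) : Cnorm (z - w) <= Cnorm z + Cnorm w.
Proof. rewrite <- (Cnorm_opp w). apply (Cnorm_triang z (- w)). Qed.

Lemma Cnorm_pos (z : Cx) : z <> Czero -> 0 < Cnorm z.
Proof. intros H. apply sqrt_lt_R0, Cx_sqr_pos, H. Qed.

Lemma Cnorm_inv (z : Cx) : z <> Czero -> Cnorm (/ z) = / Cnorm z.
Proof.
  intros H. pose proof (Cnorm_pos z H).
  apply Rmult_eq_reg_r with (Cnorm z); [|lra].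
  rewrite <- Cnorm_mul, Rinv_l by lra.
  replace (/ z * z)%Cx with (RtoC 1) by (field; assumption).
  rewrite Cnorm_RtoC; apply Rabs_R1.
Qed.

Lemma Cnorm_div (z w : Cx) : w <> Czero -> Cnorm (z / w) = Cnorm z / Cnorm w.
Proof. intros H. unfold Cdiv. now rewrite Cnorm_mul, Cnorm_inv. Qed.

Lemma Cnorm_INC (n : nat) : Cnorm (INC n) = INR n.
Proof. rewrite Cnorm_RtoC; apply Rabs_right, Rle_ge, pos_INR. Qed.

Lemma Cnorm_Cone : Cnorm Cone = 1.
Proof. unfold Cone; rewrite Cnorm_RtoC; apply Rabs_R1. Qed.

Lemma Cnorm_zero : Cnorm Czero = 0.
Proof. unfold Czero; rewrite Cnorm_RtoC; apply Rabs_R0. Qed.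

Lemma Cseq_cv_squeeze (u : nat -> Cx) (l : Cx) (e : nat -> R) :
  (exists N, forall n, (N <= n)%nat -> Cnorm (u n - l) <= e n) -> is_lim_seq e 0 -> Cseq_cv u l.
Proof.
  intros [N HN] He eps Heps.
  apply is_lim_seq_spec in He. destruct (He (mkposreal eps Heps)) as [M HM].
  exists (max N M). intros n Hn.
  apply Rle_lt_trans with (e n); [apply HN; lia|].
  specialize (HM n ltac:(lia)). simpl in HM.
  rewrite Rminus_0_r in HM. pose proof (Rle_abs (e n)). lra.
Qed.

(** Bridge to real limits: the algebraic limit rules for complex sequences are obtained
    componentwise from it. *)
Lemma Cseq_cv_parts (u : nat -> Cx) (l : Cx) :
  Cseq_cv u l <->
  is_lim_seq (fun n => Re (u n)) (Re l) /\ is_lim_seq (fun n => Im (u n)) (Im l).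
Proof.
  split.
  - intros H. split; apply is_lim_seq_spec; intros eps;
      destruct (H eps (cond_pos eps)) as [N HN]; exists N; intros n Hn;
      (eapply Rle_lt_trans; [|exact (HN n Hn)]).
    + apply (Re_le_Cnorm (u n - l)).
    + apply (Im_le_Cnorm (u n - l)).
  - intros [Hr Hi].
    apply (Cseq_cv_squeeze _ _ (fun n => Rabs (Re (u n) - Re l) + Rabs (Im (u n) - Im l))).
    + exists 0%nat; intros n _. apply (Cnorm_le_abs (u n - l)).
    + replace (Finite 0) with (Finite (Rabs (Re l - Re l) + Rabs (Im l - Im l)))
        by (do 2 f_equal; rewrite !Rminus_diag, Rabs_R0; ring).
      apply is_lim_seq_plus'; apply (is_lim_seq_abs _ (Finite _));
        apply is_lim_seq_minus'; auto; apply is_lim_seq_const.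
Qed.

Lemma Cseq_cv_ext_loc (u w : nat -> Cx) (l : Cx) (N : nat) :
  (forall n, (N <= n)%nat -> u n = w n) -> Cseq_cv u l -> Cseq_cv w l.
Proof.
  intros H Hu eps Heps. destruct (Hu eps Heps) as [M HM]. exists (max N M).
  intros n Hn. rewrite <- H by lia. apply HM; lia.
Qed.

Lemma Cseq_cv_ext (u w : nat -> Cx) (l : Cx) :
  (forall n, u n = w n) -> Cseq_cv u l -> Cseq_cv w l.
Proof. intros H. apply Cseq_cv_ext_loc with 0%nat; auto. Qed.

Lemma Cseq_cv_const (l : Cx) : Cseq_cv (fun _ => l) l.
Proof. apply Cseq_cv_parts; split; apply is_lim_seq_const. Qed.

Lemma Cseq_cv_add (u w : nat -> Cx) (l m : Cx) :
  Cseq_cv u l -> Cseq_cv w m -> Cseq_cv (fun n => u n + w n)%Cx (l + m)%Cx.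
Proof.
  intros Hu Hw. apply Cseq_cv_parts in Hu, Hw. destruct Hu, Hw.
  apply Cseq_cv_parts; split; apply is_lim_seq_plus'; assumption.
Qed.

Lemma Cseq_cv_mul (u w : nat -> Cx) (l m : Cx) :
  Cseq_cv u l -> Cseq_cv w m -> Cseq_cv (fun n => u n * w n)%Cx (l * m)%Cx.
Proof.
  intros Hu Hw. apply Cseq_cv_parts in Hu, Hw. destruct Hu, Hw.
  apply Cseq_cv_parts; split;
    [apply is_lim_seq_minus'|apply is_lim_seq_plus']; apply is_lim_seq_mult'; assumption.
Qed.

Lemma Cseq_cv_sub (u w : nat -> Cx) (l m : Cx) :
  Cseq_cv u l -> Cseq_cv w m -> Cseq_cv (fun n => u n - w n)%Cx (l - m)%Cx.
Proof.
  intros Hu Hw. apply Cseq_cv_parts in Hu, Hw. destruct Hu, Hw.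
  apply Cseq_cv_parts; split; [exact (is_lim_seq_minus' _ _ _ _ H H1)|exact (is_lim_seq_minus' _ _ _ _ H0 H2)].
Qed.

Lemma Cseq_cv_inv (u : nat -> Cx) (l : Cx) :
  l <> Czero -> Cseq_cv u l -> Cseq_cv (fun n => / u n)%Cx (/ l)%Cx.
Proof.
  intros Hl Hu. apply Cx_sqr_pos in Hl. apply Cseq_cv_parts in Hu. destruct Hu as [Hr Hi].
  assert (is_lim_seq (fun n => Re (u n) ^ 2 + Im (u n) ^ 2) (Re l ^ 2 + Im l ^ 2)).
  { apply is_lim_seq_plus'; simpl; repeat apply is_lim_seq_mult'; auto using is_lim_seq_const. }
  apply Cseq_cv_parts; split; apply is_lim_seq_div'; auto; try lra.
  exact (proj1 (is_lim_seq_opp _ (Finite _)) Hi).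
Qed.

Lemma Cseq_cv_div (u w : nat -> Cx) (l m : Cx) :
  m <> Czero -> Cseq_cv u l -> Cseq_cv w m -> Cseq_cv (fun n => u n / w n)%Cx (l / m)%Cx.
Proof. intros Hm Hu Hw. apply Cseq_cv_mul; [|apply Cseq_cv_inv]; assumption. Qed.

Lemma Cseq_cv_unique (u : nat -> Cx) (l m : Cx) : Cseq_cv u l -> Cseq_cv u m -> l = m.
Proof.
  intros Hl Hm. apply Cseq_cv_parts in Hl, Hm. destruct Hl as [H1 H2], Hm as [H3 H4].
  apply is_lim_seq_unique in H1, H2, H3, H4.
  apply Cx_ext; congruence.
Qed.

Lemma Cseq_cv_bounded (u : nat -> Cx) (l : Cx) :
  Cseq_cv u l -> exists N, forall n, (N <= n)%nat -> Cnorm (u n) <= Cnorm l + 1.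
Proof.
  intros H. destruct (H 1 Rlt_0_1) as [N HN]. exists N. intros n Hn.
  specialize (HN n Hn). pose proof (Cnorm_triang_inv (u n) l). lra.
Qed.

Lemma Cseq_cv_incr_n (u : nat -> Cx) (N : nat) (l : Cx) :
  Cseq_cv (fun n => u (n + N)%nat) l <-> Cseq_cv u l.
Proof.
  split; intros H; apply Cseq_cv_parts in H; apply Cseq_cv_parts; destruct H as [H1 H2]; split.
  - now apply (is_lim_seq_incr_n (fun n => Re (u n)) N).
  - now apply (is_lim_seq_incr_n (fun n => Im (u n)) N).
  - now apply (is_lim_seq_incr_n (fun n => Re (u n)) N) in H1.
  - now apply (is_lim_seq_incr_n (fun n => Im (u n)) N) in H2.
Qed.

(** * Infinite products and the convergence of Gauss' limit *)

Lemma ln_succ_bounds (x : R) : 0 < x -> / (x + 1) <= ln (x + 1) - ln x <= / x.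
Proof.
  intros Hx.
  assert (Hln : forall t, 0 < t -> ln t <= t - 1).
  { intros t Ht. rewrite <- (ln_exp (t - 1)). apply ln_le; [assumption|].
    pose proof (exp_ineq1_le (t - 1)). lra. }
  pose proof (Rinv_0_lt_compat x Hx). pose proof (Rinv_0_lt_compat (x + 1) ltac:(lra)).
  split.
  - assert (H1 := Hln (x / (x + 1)) ltac:(apply Rdiv_lt_0_compat; lra)).
    unfold Rdiv in H1. rewrite ln_mult, ln_Rinv in H1 by lra.
    replace (x * / (x + 1) - 1) with (- / (x + 1)) in H1 by (field; lra). lra.
  - assert (H1 := Hln ((x + 1) / x) ltac:(apply Rdiv_lt_0_compat; lra)).
    unfold Rdiv in H1. rewrite ln_mult, ln_Rinv in H1 by lra.
    replace ((x + 1) * / x - 1) with (/ x) in H1 by (field; lra). lra.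
Qed.

(** A substitute for the integral test: up to the factor d, the term (x+1)^(-1-d) is at most the
    drop of x^(-d) over one step, so the series of n^(-1-d) is dominated by a telescoping one. It
    follows from exp u >= 1 + u with the lower bound 1/(x+1) for the step of the logarithm. *)
Lemma Rpower_diff_lower (x d : R) : 0 < x -> 0 <= d ->
  d * Rpower (x + 1) (- (1 + d)) <= Rpower x (- d) - Rpower (x + 1) (- d).
Proof.
  intros Hx Hd.
  replace (- (1 + d)) with (- d + - (1)) by ring.
  rewrite Rpower_plus, (Rpower_Ropp _ 1), Rpower_1 by lra.
  pose proof (ln_succ_bounds x Hx) as [HL _].
  assert (H : Rpower x (- d) = Rpower (x + 1) (- d) * exp (d * (ln (x + 1) - ln x))).
  { unfold Rpower. rewrite <- exp_plus. f_equal. ring. }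
  rewrite H. pose proof (exp_ineq1_le (d * (ln (x + 1) - ln x))) as He.
  assert (0 < Rpower (x + 1) (- d)) by apply exp_pos.
  assert (d * / (x + 1) <= d * (ln (x + 1) - ln x)) by (apply Rmult_le_compat_l; lra).
  nra.
Qed.

Lemma sum_n_telescope (a : nat -> R) (n : nat) :
  sum_n (fun k => a (S k) - a k) n = a (S n) - a 0%nat.
Proof.
  induction n as [|n IH]; [apply sum_O|].
  rewrite sum_Sn, IH. unfold plus; simpl. ring.
Qed.

Lemma ex_series_telescope (a : nat -> R) :
  ex_series (fun k => a (S k) - a k) <-> ex_finite_lim_seq a.
Proof.
  split; intros [l Hl].
  - exists (l + a 0%nat). apply is_lim_seq_incr_1.
    apply is_lim_seq_ext with (fun n => sum_n (fun k => a (S k) - a k) n + a 0%nat).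
    + intros n. rewrite sum_n_telescope. ring.
    + apply is_lim_seq_plus'; [exact Hl|apply is_lim_seq_const].
  - exists (l - a 0%nat).
    change (is_lim_seq (sum_n (fun k => a (S k) - a k)) (l - a 0%nat)).
    apply is_lim_seq_ext with (fun n => a (S n) - a 0%nat).
    + intros n. now rewrite sum_n_telescope.
    + apply is_lim_seq_minus'; [|apply is_lim_seq_const]. now apply is_lim_seq_incr_1 in Hl.
Qed.

Lemma ex_series_Rpower (d : R) : 0 < d ->
  ex_series (fun n => Rpower (INR (S n)) (- (1 + d))).
Proof.
  intros Hd. apply ex_series_incr_1.
  apply (@ex_series_le R_AbsRing R_CompleteNormedModule) with
    (fun n => / d * (Rpower (INR (S n)) (- d) - Rpower (INR (S (S n))) (- d))).
  - intros n. change norm with Rabs.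
    rewrite Rabs_right by (apply Rle_ge, Rlt_le, exp_pos).
    pose proof (Rpower_diff_lower (INR (S n)) d ltac:(apply lt_0_INR; lia) ltac:(lra)) as H.
    rewrite <- S_INR in H.
    apply Rmult_le_reg_l with d; [assumption|].
    rewrite <- Rmult_assoc, Rinv_r, Rmult_1_l by lra. exact H.
  - apply (ex_series_scal_l (/ d) (fun n => Rpower (INR (S n)) (- d) - Rpower (INR (S (S n))) (- d))).
    apply ex_series_ext with
      (fun n => - Rpower (INR (S (S n))) (- d) - - Rpower (INR (S n)) (- d)).
    { intros n. match goal with |- ?x = ?y => change (@eq R x y) end. ring. }
    apply (ex_series_telescope (fun n => - Rpower (INR (S n)) (- d))).
    apply ex_finite_lim_seq_incr with 0.
    + intros n. apply Ropp_le_contravar.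
      pose proof (Rpower_diff_lower (INR (S n)) d ltac:(apply lt_0_INR; lia) ltac:(lra)) as H.
      rewrite <- S_INR in H.
      pose proof (exp_pos (- (1 + d) * ln (INR (S (S n))))) as Hp. fold (Rpower (INR (S (S n))) (- (1 + d))) in Hp.
      nra.
    + intros n. pose proof (exp_pos (- d * ln (INR (S n)))). unfold Rpower. lra.
Qed.

Lemma ex_series_inv_sqr : ex_series (fun n => / INR (S n) ^ 2).
Proof.
  eapply ex_series_ext; [|exact (ex_series_Rpower 1 Rlt_0_1)].
  intros n. simpl. rewrite Rpower_Ropp. f_equal.
  replace (1 + 1) with (INR 2) by (simpl; ring).
  apply Rpower_pow. apply (lt_0_INR (S n)); lia.
Qed.

Lemma Cseq_cv_of_increments (u : nat -> Cx) (e : nat -> R) :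
  (forall n, Cnorm (u (S n) - u n) <= e n) -> ex_series e -> exists l, Cseq_cv u l.
Proof.
  intros Hu He.
  assert (Hr : ex_finite_lim_seq (fun n => Re (u n))).
  { apply ex_series_telescope.
    apply (@ex_series_le R_AbsRing R_CompleteNormedModule) with e; [|assumption].
    intros n. eapply Rle_trans; [|apply Hu]. apply (Re_le_Cnorm (u (S n) - u n)). }
  assert (Hi : ex_finite_lim_seq (fun n => Im (u n))).
  { apply ex_series_telescope.
    apply (@ex_series_le R_AbsRing R_CompleteNormedModule) with e; [|assumption].
    intros n. eapply Rle_trans; [|apply Hu]. apply (Im_le_Cnorm (u (S n) - u n)). }
  destruct Hr as [x Hx], Hi as [y Hy]. exists (mkC x y). now apply Cseq_cv_parts.
Qed.

Lemma sum_n_le_Series (e : nat -> R) (n : nat) :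
  (forall k, 0 <= e k) -> ex_series e -> sum_n e n <= Series e.
Proof.
  intros He Hs. apply (is_lim_seq_incr_compare (sum_n e)).
  - apply (Series_correct e Hs).
  - intros k. rewrite sum_Sn. unfold plus; simpl. specialize (He (S k)). lra.
Qed.

(** No logarithms are taken: since 1 + e <= exp e, the partial products are bounded by a multiple of
    exp of the sum of [e], and the increments u_n (f_n - 1) are then dominated by a multiple of
    [e]. *)
Lemma Cseq_cv_infinite_product (u f : nat -> Cx) (e : nat -> R) :
  (forall n, u (S n) = (u n * f n)%Cx) -> (forall n, Cnorm (f n - Cone) <= e n) ->
  ex_series e -> exists l, Cseq_cv u l.
Proof.
  intros Hu Hf He.
  assert (He0 : forall n, 0 <= e n).
  { intros n. eapply Rle_trans; [apply Cnorm_ge0|apply Hf]. }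
  assert (Hb1 : forall n, Cnorm (u (S n)) <= Cnorm (u 0%nat) * exp (sum_n e n)).
  { assert (Hs : forall n, Cnorm (u (S n)) <= Cnorm (u n) * exp (e n)).
    { intros n. rewrite Hu, Cnorm_mul. apply Rmult_le_compat_l; [apply Cnorm_ge0|].
      apply Rle_trans with (1 + e n); [|apply exp_ineq1_le].
      pose proof (Cnorm_triang_inv (f n) Cone). rewrite Cnorm_Cone in *.
      specialize (Hf n). lra. }
    induction n as [|n IH].
    - rewrite sum_O. apply Hs.
    - rewrite sum_Sn. unfold plus; simpl. rewrite exp_plus, <- Rmult_assoc.
      eapply Rle_trans; [apply Hs|]. apply Rmult_le_compat_r; [apply Rlt_le, exp_pos|exact IH]. }
  set (B := Cnorm (u 0%nat) * exp (Series e)).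
  assert (Hb : forall n, Cnorm (u (S n)) <= B).
  { intros n. eapply Rle_trans; [apply Hb1|]. apply Rmult_le_compat_l; [apply Cnorm_ge0|].
    destruct (sum_n_le_Series e n He0 He) as [H|H]; [left; now apply exp_increasing|rewrite H; lra]. }
  destruct (Cseq_cv_of_increments (fun n => u (S n)) (fun n => B * e (S n))) as [l Hl].
  - intros n. rewrite (Hu (S n)).
    replace (u (S n) * f (S n) - u (S n))%Cx with (u (S n) * (f (S n) - Cone))%Cx by ring.
    rewrite Cnorm_mul. apply Rmult_le_compat; auto using Cnorm_ge0.
  - apply (ex_series_scal_l B (fun n => e (S n))). now apply ex_series_incr_1 in He.
  - exists l. apply (Cseq_cv_incr_n u 1).
    apply Cseq_cv_ext with (2 := Hl). intros n. f_equal. lia.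
Qed.

(* The reciprocals of the partial products satisfy the same hypotheses from some index on;
   as they converge too, the limit cannot vanish. *)
Lemma Cseq_cv_infinite_product_neq0 (u f : nat -> Cx) (e : nat -> R) :
  (forall n, u (S n) = (u n * f n)%Cx) -> (forall n, Cnorm (f n - Cone) <= e n) ->
  ex_series e -> (forall n, u n <> Czero) -> exists l, Cseq_cv u l /\ l <> Czero.
Proof.
  intros Hu Hf He Hu0.
  destruct (Cseq_cv_infinite_product u f e Hu Hf He) as [l Hl]. exists l; split; [assumption|].
  assert (Hf0 : forall n, f n <> Czero).
  { intros n Hn. apply (Hu0 (S n)). rewrite Hu, Hn. ring. }
  pose proof (ex_series_lim_0 e He) as Hlim. apply is_lim_seq_spec in Hlim.
  (* Beyond [N] the factors have norm at least 1/2, so passing to their reciprocals at most doubles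
     the distance to 1. *)
  destruct (Hlim (mkposreal (1/2) ltac:(lra))) as [N HN]; simpl in HN.
  assert (Hinv : exists m, Cseq_cv (fun n => / u (n + N)%nat)%Cx m).
  { apply (Cseq_cv_infinite_product _ (fun n => / f (n + N)%nat)%Cx (fun n => 2 * e (n + N)%nat)).
    - intros n. change (S n + N)%nat with (S (n + N)). rewrite Hu. field. auto.
    - intros n. set (k := (n + N)%nat).
      assert (Hk : f k <> Czero) by auto.
      replace (/ f k - Cone)%Cx with ((Cone - f k) / f k)%Cx by (field; assumption).
      rewrite Cnorm_div, Cnorm_sub_sym by assumption.
      specialize (HN k ltac:(unfold k; lia)). rewrite Rminus_0_r in HN.
      pose proof (Rle_abs (e k)). specialize (Hf k).
      pose proof (Cnorm_triang_inv Cone (Cone - f k)) as Ht.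
      rewrite Cnorm_Cone in Ht. rewrite (Cnorm_sub_sym Cone (f k)) in Ht.
      replace (Cone - (Cone - f k))%Cx with (f k) in Ht by ring.
      apply Rmult_le_reg_r with (Cnorm (f k)); [lra|].
      unfold Rdiv. rewrite Rmult_assoc, Rinv_l, Rmult_1_r by lra.
      pose proof (Cnorm_ge0 (f k - Cone)). nra.
    - apply (ex_series_scal_l 2 (fun n => e (n + N)%nat)).
      apply ex_series_ext with (fun n => e (N + n)%nat).
      + intros n; f_equal; lia.
      + now apply ex_series_incr_n. }
  destruct Hinv as [m Hm]. intros E.
  assert (H1 : Cseq_cv (fun _ => Cone) (l * m)%Cx).
  { eapply Cseq_cv_ext; [|apply Cseq_cv_mul; [apply (Cseq_cv_incr_n u N); exact Hl|exact Hm]].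
    intros n; simpl. field. auto. }
  pose proof (Cseq_cv_unique _ _ _ H1 (Cseq_cv_const Cone)) as H2.
  rewrite E in H2. apply (F_1_neq_0 Cx_field_theory). rewrite <- H2. ring.
Qed.

(** * The complex exponential near 0 *)

Lemma Cexp_add (z w : Cx) : Cexp (z + w) = (Cexp z * Cexp w)%Cx.
Proof. apply Cx_ext; simpl; rewrite exp_plus, ?cos_plus, ?sin_plus; ring. Qed.

Lemma Cexp_zero : Cexp Czero = Cone.
Proof. apply Cx_ext; simpl; rewrite exp_0, ?cos_0, ?sin_0; ring. Qed.

Lemma Cexp_neq0 (z : Cx) : Cexp z <> Czero.
Proof.
  intros H. apply (F_1_neq_0 Cx_field_theory). rewrite <- Cexp_zero.
  replace Czero with (z + - z)%Cx at 1 by ring. rewrite Cexp_add, H. ring.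
Qed.

Lemma Cnorm_Cexp (z : Cx) : Cnorm (Cexp z) = exp (Re z).
Proof.
  apply Cnorm_eq; [apply Rlt_le, exp_pos|]. simpl.
  pose proof (sin2_cos2 (Im z)) as H. unfold Rsqr in H.
  transitivity (exp (Re z) * exp (Re z) * (sin (Im z) * sin (Im z) + cos (Im z) * cos (Im z))); [ring|].
  rewrite H. ring.
Qed.

Lemma one_sub_cos_bounds (y : R) : 0 <= 1 - cos y <= y ^ 2 / 2.
Proof.
  replace (cos y) with (cos (2 * (y / 2))) by (f_equal; field).
  rewrite cos_2a_sin.
  assert (Hs : Rabs (sin (y / 2)) <= Rabs (y / 2)).
  { destruct (Rtotal_order (y / 2) 0) as [Hy|[Hy|Hy]].
    - apply Rabs_le_between. rewrite (Rabs_left (y / 2)) by assumption.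
      pose proof (sin_lt_x (- (y / 2)) ltac:(lra)) as H1. rewrite sin_neg in H1.
      destruct (Rle_dec (-1) (y / 2)) as [Hy1|Hy1].
      + pose proof (sin_gt_0 (- (y / 2)) ltac:(lra) ltac:(pose proof PI2_1; lra)) as H2.
        rewrite sin_neg in H2. lra.
      + pose proof (SIN_bound (y / 2)). lra.
    - rewrite Hy, sin_0. lra.
    - apply Rabs_le_between. rewrite (Rabs_right (y / 2)) by lra.
      pose proof (sin_lt_x (y / 2) ltac:(lra)) as H1.
      destruct (Rle_dec (y / 2) 1) as [Hy1|Hy1].
      + pose proof (sin_gt_0 (y / 2) ltac:(lra) ltac:(pose proof PI2_1; lra)). lra.
      + pose proof (SIN_bound (y / 2)). lra. }
  assert (Hq : sin (y / 2) ^ 2 <= (y / 2) ^ 2).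
  { rewrite <- (pow2_abs (sin _)), <- (pow2_abs (y / 2)). apply pow_incr. split; [apply Rabs_pos|exact Hs]. }
  split; nra.
Qed.

Lemma sin_sub_id_bound (y : R) : Rabs y <= 1 -> Rabs (sin y - y) <= y ^ 2.
Proof.
  assert (H0 : forall t, 0 <= t <= 1 -> Rabs (sin t - t) <= t ^ 2).
  (* The alternating Taylor bound of lowest order: sin t >= t - t^3/6. *)
  { intros t Ht. destruct (pre_sin_bound t 0 ltac:(lra) ltac:(lra)) as [H1 H2].
    unfold sin_approx, sin_term in H1. simpl in H1.
    apply Rabs_le_between. split.
    - assert (t * t * t <= t * t * 1) by (apply Rmult_le_compat_l; nra). nra.
    - destruct (Req_dec t 0) as [->|Ht0]; [rewrite sin_0; lra|].
      pose proof (sin_lt_x t ltac:(lra)). nra. }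
  intros Hy. destruct (Rle_dec 0 y) as [H|H].
  - rewrite Rabs_right in Hy by lra. apply H0; lra.
  - rewrite Rabs_left in Hy by lra.
    replace (sin y - y) with (- (sin (- y) - - y)) by (rewrite sin_neg; ring).
    rewrite Rabs_Ropp. replace (y ^ 2) with ((- y) ^ 2) by ring. apply H0; lra.
Qed.

(** A remainder of second order is what makes the factors of Gauss' product 1 + O(1/n^2). Since the
    exponential is given by its parts, these are estimated separately: together they give 2x^2 +
    2y^2 + 4|xy|, hence the constant 4. *)
Lemma Cexp_taylor1 (z : Cx) : Cnorm z <= 1 / 2 ->
  Cnorm (Cexp z - Cone - z) <= 4 * Cnorm z ^ 2.
Proof.
  intros Hz. pose proof (Re_le_Cnorm z) as Hx. pose proof (Im_le_Cnorm z) as Hy.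
  rewrite Cnorm_sqr. set (x := Re z) in *. set (y := Im z) in *.
  assert (Hx1 : Rabs x <= 1 / 2) by lra. assert (Hy1 : Rabs y <= 1) by lra.
  apply Rabs_le_between in Hx1.
  assert (He : Rabs (exp x - 1 - x) <= 2 * x ^ 2).
  { pose proof (exp_ineq1_le x). pose proof (exp_ineq1_le (- x)) as Hn.
    rewrite exp_Ropp in Hn. pose proof (exp_pos x) as Hp.
    assert (exp x * (1 + - x) <= 1).
    { replace 1 with (exp x * / exp x) at 2 by (field; lra). apply Rmult_le_compat_l; lra. }
    rewrite Rabs_right by lra. nra. }
  assert (He1 : Rabs (exp x - 1) <= 2 * Rabs x).
  { replace (exp x - 1) with ((exp x - 1 - x) + x) by ring.
    eapply Rle_trans; [apply Rabs_triang|].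
    rewrite <- pow2_abs in He. assert (Rabs x <= 1 / 2) by (apply Rabs_le_between; lra).
    pose proof (Rabs_pos x). nra. }
  assert (He2 : exp x <= 2).
  { assert (Rabs x <= 1 / 2) by (apply Rabs_le_between; lra). apply Rabs_le_between in He1. lra. }
  pose proof (one_sub_cos_bounds y) as Hc. pose proof (sin_sub_id_bound y Hy1) as Hs.
  eapply Rle_trans; [apply Cnorm_le_abs|]. simpl Re; simpl Im. fold x y.
  replace (exp x * cos y + - (1) + - x) with ((exp x - 1 - x) - exp x * (1 - cos y)) by ring.
  replace (exp x * sin y + - 0 + - y) with ((exp x - 1) * sin y + (sin y - y)) by ring.
  assert (A1 : Rabs (exp x - 1 - x - exp x * (1 - cos y)) <= 2 * x ^ 2 + y ^ 2).
  { pose proof (exp_pos x). apply Rabs_le_between in He. apply Rabs_le_between.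
    assert (0 <= exp x * (1 - cos y) <= y ^ 2) by (split; nra). split; nra. }
  assert (A2 : Rabs ((exp x - 1) * sin y + (sin y - y)) <= 2 * Rabs x * (2 * Rabs y) + y ^ 2).
  { eapply Rle_trans; [apply Rabs_triang|]. apply Rplus_le_compat; [|exact Hs].
    rewrite Rabs_mult. apply Rmult_le_compat; auto using Rabs_pos.
    replace (sin y) with ((sin y - y) + y) by ring.
    eapply Rle_trans; [apply Rabs_triang|]. rewrite <- pow2_abs in Hs. pose proof (Rabs_pos y). nra. }
  rewrite <- (pow2_abs x) in *. rewrite <- (pow2_abs y) in *.
  assert (0 <= (Rabs x - Rabs y) ^ 2) by apply pow2_ge_0. nra.
Qed.

(** * Pochhammer symbols and Gauss' limit for the Gamma function *)

Lemma poch_neq0 (z : Cx) (n : nat) : notZ0neg z -> poch z n <> Czero.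
Proof.
  intros Hz. induction n as [|n IH]; simpl; [apply (F_1_neq_0 Cx_field_theory)|].
  apply Cmul_neq0; [assumption|]. intros E. apply (Hz n).
  rewrite RtoC_opp. transitivity (z + INC n - INC n)%Cx; [ring|rewrite E; ring].
Qed.

Lemma add_INC_neq0 (z : Cx) (n : nat) : notZ0neg z -> (z + INC n)%Cx <> Czero.
Proof.
  intros Hz E. apply (Hz n).
  rewrite RtoC_opp. transitivity (z + INC n - INC n)%Cx; [ring|rewrite E; ring].
Qed.

Lemma Cfact_S (n : nat) : Cfact (S n) = (Cfact n * (INC n + Cone))%Cx.
Proof. unfold Cfact. rewrite fact_simpl, mult_INR, RtoC_mul, INC_S. ring. Qed.

Lemma Cfact_neq0 (n : nat) : Cfact n <> Czero.
Proof. apply RtoC_neq0, not_0_INR, fact_neq_0. Qed.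

Lemma gauss_seq_neq0 (z : Cx) (n : nat) : notZ0neg z -> gauss_seq z n <> Czero.
Proof.
  intros Hz. apply Cdiv_neq0; [|now apply poch_neq0].
  apply Cmul_neq0; [apply Cfact_neq0|apply Cexp_neq0].
Qed.

(** The increment of the logarithm is kept unsimplified, so that the recurrence also holds at n = 0,
    whatever the value of [ln 0]. *)
Definition gauss_ratio (z : Cx) (n : nat) : Cx :=
  ((INC n + Cone) * Cexp (z * RtoC (ln (INR n + 1) - ln (INR n))) / (z + INC (S n)))%Cx.

Lemma gauss_seq_S (z : Cx) (n : nat) : notZ0neg z ->
  gauss_seq z (S n) = (gauss_seq z n * gauss_ratio z n)%Cx.
Proof.
  intros Hz. unfold gauss_seq, gauss_ratio, Cnpow.
  replace (z * RtoC (ln (INR (S n))))%Cx with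
    (z * RtoC (ln (INR n)) + z * RtoC (ln (INR n + 1) - ln (INR n)))%Cx
    by (rewrite S_INR, RtoC_sub; ring).
  rewrite Cexp_add, Cfact_S. change (poch z (S (S n))) with (poch z (S n) * (z + INC (S n)))%Cx.
  field. split; [now apply add_INC_neq0|now apply poch_neq0].
Qed.

(** The terms of first order cancel. With h = ln(n+1) - ln n and rho the Taylor remainder, the
    numerator (n+1) exp(z h) - (n+1+z) equals z ((n+1) h - 1) + (n+1) rho. Both summands are O(1/n),
    and the denominator has norm at least n/2. *)
Lemma gauss_ratio_bound (z : Cx) (n : nat) :
  (1 <= n)%nat -> 2 * Cnorm z <= INR n ->
  Cnorm (gauss_ratio z n - Cone) <= 2 * (Cnorm z + 8 * Cnorm z ^ 2) * / INR n ^ 2.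
Proof.
  intros Hn Hz. unfold gauss_ratio.
  assert (Hx : 1 <= INR n) by (apply (le_INR 1); assumption).
  rewrite INC_S. rewrite RtoC_sub.
  set (x := INR n) in *.
  pose proof (ln_succ_bounds x ltac:(lra)) as [Hh1 Hh2]. rewrite <- RtoC_sub.
  set (h := ln (x + 1) - ln x) in *.
  pose proof (Cnorm_ge0 z) as Hz0.
  pose proof (Rinv_0_lt_compat x ltac:(lra)) as Hi.
  pose proof (Rinv_0_lt_compat (x + 1) ltac:(lra)) as Hi1.
  assert (Hxx : x * / x = 1) by (apply Rinv_r; lra).
  assert (Hxx1 : (x + 1) * / (x + 1) = 1) by (apply Rinv_r; lra).
  assert (Hzh : Cnorm (z * RtoC h) = Cnorm z * h).
  { rewrite Cnorm_mul, Cnorm_RtoC, Rabs_right; lra. }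
  assert (Hzh' : Cnorm z * h <= Cnorm z * / x) by (apply Rmult_le_compat_l; lra).
  assert (Hzx : Cnorm z * / x <= 1 / 2).
  { apply Rmult_le_reg_r with x; [lra|]. rewrite Rmult_assoc, Rinv_l by lra. lra. }
  pose proof (Cexp_taylor1 (z * RtoC h) ltac:(lra)) as HE. rewrite Hzh in HE.
  set (rho := (Cexp (z * RtoC h) - Cone - z * RtoC h)%Cx) in *.
  set (D := (z + (RtoC x + Cone))%Cx).
  assert (HD : x / 2 <= Cnorm D).
  { pose proof (Cnorm_triang_inv (RtoC x + Cone) (- z)) as Ht.
    rewrite Cnorm_opp in Ht. replace (RtoC x + Cone - - z)%Cx with D in Ht by (unfold D; ring).
    unfold Cone in Ht. rewrite <- RtoC_add, Cnorm_RtoC, Rabs_right in Ht by lra. lra. }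
  assert (HD0 : D <> Czero).
  { intros E. rewrite E, Cnorm_zero in HD. lra. }
  replace ((RtoC x + Cone) * Cexp (z * RtoC h) / D - Cone)%Cx
    with ((z * RtoC ((x + 1) * h - 1) + RtoC (x + 1) * rho) / D)%Cx.
  2:{ unfold rho. rewrite RtoC_sub, RtoC_mul, RtoC_add. fold Cone.
      unfold D in *. field. exact HD0. }
  rewrite Cnorm_div by assumption.
  assert (Hnum : Cnorm (z * RtoC ((x + 1) * h - 1) + RtoC (x + 1) * rho) <= (Cnorm z + 8 * Cnorm z ^ 2) * / x).
  { eapply Rle_trans; [apply Cnorm_triang|]. rewrite !Cnorm_mul, !Cnorm_RtoC.
    assert (H1 : 0 <= (x + 1) * h - 1 <= / x).
    { assert (G1 : (x + 1) * / (x + 1) <= (x + 1) * h) by (apply Rmult_le_compat_l; lra).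
      assert (G2 : (x + 1) * h <= (x + 1) * / x) by (apply Rmult_le_compat_l; lra). lra. }
    rewrite (Rabs_right ((x + 1) * h - 1)), (Rabs_right (x + 1)) by lra.
    rewrite (Rmult_plus_distr_r (Cnorm z)). apply Rplus_le_compat; [apply Rmult_le_compat_l; lra|].
    apply Rle_trans with (2 * x * (4 * (Cnorm z * / x) ^ 2)).
    - apply Rmult_le_compat; try lra; [apply Cnorm_ge0|]. eapply Rle_trans; [exact HE|].
      apply Rmult_le_compat_l; [lra|]. apply pow_incr. split; [|lra]. apply Rmult_le_pos; lra.
    - right. replace (2 * x * (4 * (Cnorm z * / x) ^ 2)) with (8 * Cnorm z ^ 2 * / x * (x * / x)) by ring.
      rewrite Hxx; ring. }
  apply Rmult_le_reg_r with (Cnorm D); [lra|].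
  unfold Rdiv. rewrite Rmult_assoc, Rinv_l, Rmult_1_r by lra.
  eapply Rle_trans; [exact Hnum|].
  set (A := Cnorm z + 8 * Cnorm z ^ 2). assert (HA : 0 <= A) by (unfold A; nra).
  apply Rle_trans with (2 * A * / x ^ 2 * (x / 2)).
  - right. field. lra.
  - apply Rmult_le_compat_l; [|lra].
    apply Rmult_le_pos; [lra|]. apply Rlt_le, Rinv_0_lt_compat, pow_lt. lra.
Qed.

(** The product is started at an index [N] above 2|z|, where the ratio bound applies. A nonzero
    limit is required because Gamma(v) occurs as a divisor. *)
Lemma gauss_seq_cv (z : Cx) : notZ0neg z ->
  exists l, Cseq_cv (gauss_seq z) l /\ l <> Czero.
Proof.
  intros Hz. destruct (INR_unbounded (2 * Cnorm z)) as [N0 HN0].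
  set (N := S N0).
  destruct (Cseq_cv_infinite_product_neq0 (fun n => gauss_seq z (n + N))
    (fun n => gauss_ratio z (n + N))
    (fun n => 2 * (Cnorm z + 8 * Cnorm z ^ 2) * / INR (S n) ^ 2)) as [l [Hl Hl0]].
  - intros n. now apply gauss_seq_S.
  - intros n. eapply Rle_trans; [apply gauss_ratio_bound; [unfold N; lia|]|].
    + apply Rle_trans with (INR N0); [lra|]. apply le_INR; unfold N; lia.
    + pose proof (Cnorm_ge0 z). apply Rmult_le_compat_l; [nra|].
      assert (H1 : 0 < INR (S n)) by (apply lt_0_INR; lia).
      apply Rinv_le_contravar; [now apply pow_lt|].
      apply pow_incr. split; [lra|]. apply le_INR; unfold N; lia.
  - apply (ex_series_scal_l (2 * (Cnorm z + 8 * Cnorm z ^ 2)) (fun n => / INR (S n) ^ 2)).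
    apply ex_series_inv_sqr.
  - intros n. now apply gauss_seq_neq0.
  - exists l; split; [|assumption]. now apply (Cseq_cv_incr_n (gauss_seq z) N).
Qed.

Lemma CGamma_correct (z : Cx) : notZ0neg z -> Cseq_cv (gauss_seq z) (CGamma z).
Proof.
  intros Hz. destruct (gauss_seq_cv z Hz) as [l [Hl _]].
  unfold CGamma. apply epsilon_spec. now exists l.
Qed.

Lemma CGamma_neq0 (z : Cx) : notZ0neg z -> CGamma z <> Czero.
Proof.
  intros Hz. destruct (gauss_seq_cv z Hz) as [l [Hl Hl0]].
  now rewrite (Cseq_cv_unique _ _ _ (CGamma_correct z Hz) Hl).
Qed.

(** * The Euler product of the cosine *)

Lemma is_derive_cos (t : R) : is_derive cos t (- sin t).
Proof. apply is_derive_Reals, derivable_pt_lim_cos. Qed.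

Lemma is_derive_sin (t : R) : is_derive sin t (cos t).
Proof. apply is_derive_Reals, derivable_pt_lim_sin. Qed.

(* For [g t = cos (2 z t)] the moments [I_n] satisfy [(n^2 - 4 z^2) I_n = n (n-1) I_{n-2}] and
   [(1 - 4 z^2) I_1 = cos (pi z)]; unrolled along odd [n], this is the partial Euler product
   with remainder [I_n(z) / I_n(0)], which tends to [1]. *)
Definition cos_moment (g : R -> R) (n : nat) : R := RInt (fun t => cos t ^ n * g t) 0 (PI / 2).

Lemma continuous_cos_pow (n : nat) (t : R) : continuous (fun t => cos t ^ n) t.
Proof.
  apply (@ex_derive_continuous R_AbsRing R_NormedModule). auto_derive. exact I.
Qed.

Lemma ex_RInt_cos_pow (g : R -> R) (n : nat) (a b : R) :
  (forall t, continuous g t) -> ex_RInt (fun t => cos t ^ n * g t) a b.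
Proof.
  intros Hg. apply (@ex_RInt_continuous R_CompleteNormedModule). intros t _.
  apply (continuous_mult (fun t => cos t ^ n) g); auto using continuous_cos_pow.
Qed.

Lemma cos_moment_correct (g : R -> R) (n : nat) : (forall t, continuous g t) ->
  is_RInt (fun t => cos t ^ n * g t) 0 (PI / 2) (cos_moment g n).
Proof. intros Hg. apply (@RInt_correct R_CompleteNormedModule), ex_RInt_cos_pow, Hg. Qed.

Lemma cos_moment_lin (g h : R -> R) (p q : R) (n : nat) :
  (forall t, continuous g t) -> (forall t, continuous h t) ->
  cos_moment (fun t => p * g t + q * h t) n = p * cos_moment g n + q * cos_moment h n.
Proof.
  intros Hg Hh. unfold cos_moment at 1. apply (@is_RInt_unique R_CompleteNormedModule).
  apply (is_RInt_ext (V:=R_NormedModule)) with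
    (fun t => plus (scal p (cos t ^ n * g t)) (scal q (cos t ^ n * h t))).
  { intros t _. unfold plus, scal; simpl; unfold mult; simpl. ring. }
  apply (is_RInt_plus (V:=R_NormedModule)); apply (is_RInt_scal (V:=R_NormedModule)); apply cos_moment_correct; assumption.
Qed.

Lemma is_derive_cos_pow (n : nat) (t : R) :
  is_derive (fun t => cos t ^ S n) t (- INR (S n) * sin t * cos t ^ n).
Proof.
  evar_last; [apply is_derive_pow, is_derive_cos|]. simpl pred. ring.
Qed.

Section integration_by_parts.
Variables g g1 g2 : R -> R.
Hypothesis Hg : forall t, is_derive g t (g1 t).
Hypothesis Hg1 : forall t, is_derive g1 t (g2 t).
Hypothesis Hg2 : forall t, continuous g2 t.
Hypothesis Hg10 : g1 0 = 0.

Lemma continuous_of_derive : forall t, continuous g t.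
Proof. intros t. apply (@ex_derive_continuous R_AbsRing R_NormedModule). eexists; apply Hg. Qed.

(** Two integrations by parts at once: the integrand is the derivative of [prim]. At [PI / 2] the
    powers of the cosine kill the boundary term, at 0 the sine and [Hg10] do. *)
Lemma cos_moment_step (n : nat) :
  cos_moment g2 (S (S n)) + INR (S (S n)) ^ 2 * cos_moment g (S (S n))
  = INR (S (S n)) * INR (S n) * cos_moment g n.
Proof.
  set (N := INR (S (S n))). set (N1 := INR (S n)).
  assert (HN : N = N1 + 1) by apply S_INR.
  assert (H1 : is_RInt (fun t => cos t ^ S (S n) * g2 t + N ^ 2 * (cos t ^ S (S n) * g t)
     - N * N1 * (cos t ^ n * g t)) 0 (PI / 2)
     (cos_moment g2 (S (S n)) + N ^ 2 * cos_moment g (S (S n)) - N * N1 * cos_moment g n)).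
  { apply (is_RInt_minus (V:=R_NormedModule)).
    - apply (is_RInt_plus (V:=R_NormedModule)).
      + apply cos_moment_correct, Hg2.
      + apply (is_RInt_scal (V:=R_NormedModule)), cos_moment_correct, continuous_of_derive.
    - apply (is_RInt_scal (V:=R_NormedModule)), cos_moment_correct, continuous_of_derive. }
  set (prim := fun t => cos t ^ S (S n) * g1 t + N * cos t ^ S n * sin t * g t).
  assert (H2 : is_RInt (fun t => cos t ^ S (S n) * g2 t + N ^ 2 * (cos t ^ S (S n) * g t)
     - N * N1 * (cos t ^ n * g t)) 0 (PI / 2) (minus (prim (PI / 2)) (prim 0))).
  { apply (is_RInt_derive (V:=R_CompleteNormedModule)).
    - intros t _. unfold prim.
      pose proof (is_derive_cos_pow (S n) t) as D1. fold N in D1.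
      pose proof (is_derive_cos_pow n t) as D2. fold N1 in D2.
      evar_last.
      + apply (is_derive_plus (V:=R_NormedModule)).
        * exact (is_derive_mult (fun t => cos t ^ S (S n)) g1 t _ _ D1 (Hg1 t)).
        * exact (is_derive_mult (fun t => N * cos t ^ S n * sin t) g t _ _
            (is_derive_mult (fun t => N * cos t ^ S n) sin t _ _
              (is_derive_scal (fun t => cos t ^ S n) t N _ D2) (is_derive_sin t)) (Hg t)).
      + unfold plus, mult; simpl. rewrite HN.
        pose proof (sin2_cos2 t) as Hsc. unfold Rsqr in Hsc.
        set (p := cos t ^ n). set (s := sin t) in *. set (c := cos t) in *.
        assert (Hs : s * s = 1 - c * c) by lra.
        match goal with |- ?l = ?r =>
          assert (E : l - r = (N1 + 1) * N1 * p * g t * (1 - c * c - s * s)) by ring end.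
        rewrite Hs, Rminus_diag, Rmult_0_r in E. lra.
    - intros t _. apply (continuous_minus (V:=R_NormedModule)).
      + apply (continuous_plus (V:=R_NormedModule)).
        * apply (continuous_mult (fun t => cos t ^ S (S n)) g2); auto using continuous_cos_pow.
        * apply (continuous_scal_r (V:=R_NormedModule) (N ^ 2) (fun t => cos t ^ S (S n) * g t)).
          apply (continuous_mult (fun t => cos t ^ S (S n)) g); auto using continuous_cos_pow, continuous_of_derive.
      + apply (continuous_scal_r (V:=R_NormedModule) (N * N1) (fun t => cos t ^ n * g t)).
        apply (continuous_mult (fun t => cos t ^ n) g); auto using continuous_cos_pow, continuous_of_derive. }
  pose proof (is_RInt_unique (V:=R_CompleteNormedModule) _ _ _ _ H1) as E1.
  pose proof (is_RInt_unique (V:=R_CompleteNormedModule) _ _ _ _ H2) as E2.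
  rewrite E1 in E2.
  unfold prim, minus, plus, opp in E2. simpl in E2.
  rewrite cos_PI2, sin_0, Hg10 in E2. lra.
Qed.

(** In the lowest case the boundary term at [PI / 2] survives; for cos(2 z t) it is the value cos(pi
    z) that the Euler product represents. *)
Lemma cos_moment_one : cos_moment g2 1 + cos_moment g 1 = g (PI / 2).
Proof.
  assert (H1 : is_RInt (fun t => cos t ^ 1 * g2 t + cos t ^ 1 * g t) 0 (PI / 2)
     (cos_moment g2 1 + cos_moment g 1)).
  { apply (is_RInt_plus (V:=R_NormedModule)); apply cos_moment_correct; auto using continuous_of_derive. }
  set (prim := fun t => cos t * g1 t + sin t * g t).
  assert (H2 : is_RInt (fun t => cos t ^ 1 * g2 t + cos t ^ 1 * g t) 0 (PI / 2)
     (minus (prim (PI / 2)) (prim 0))).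
  { apply (is_RInt_derive (V:=R_CompleteNormedModule)).
    - intros t _. unfold prim. evar_last.
      + apply (is_derive_plus (V:=R_NormedModule)).
        * exact (is_derive_mult cos g1 t _ _ (is_derive_cos t) (Hg1 t)).
        * exact (is_derive_mult sin g t _ _ (is_derive_sin t) (Hg t)).
      + unfold plus, mult; simpl. ring.
    - intros t _. apply (continuous_plus (V:=R_NormedModule)).
      + apply (continuous_mult (fun t => cos t ^ 1) g2); auto using continuous_cos_pow.
      + apply (continuous_mult (fun t => cos t ^ 1) g); auto using continuous_cos_pow, continuous_of_derive. }
  pose proof (is_RInt_unique (V:=R_CompleteNormedModule) _ _ _ _ H1) as E1.
  pose proof (is_RInt_unique (V:=R_CompleteNormedModule) _ _ _ _ H2) as E2.
  rewrite E1 in E2.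
  unfold prim, minus, plus, opp in E2. simpl in E2.
  rewrite cos_PI2, sin_PI2, sin_0, Hg10 in E2. lra.
Qed.
End integration_by_parts.

Definition wallis (n : nat) : R := cos_moment (fun _ => 1) n.

Lemma wallis_step (n : nat) : INR (S (S n)) * wallis (S (S n)) = INR (S n) * wallis n.
Proof.
  pose proof (cos_moment_step (fun _ => 1) (fun _ => 0) (fun _ => 0)
    ltac:(intros; apply (@is_derive_const R_AbsRing R_NormedModule))
    ltac:(intros; apply (@is_derive_const R_AbsRing R_NormedModule))
    ltac:(intros; apply continuous_const) eq_refl n) as H.
  assert (H0 : cos_moment (fun _ => 0) (S (S n)) = 0).
  { unfold cos_moment. rewrite (RInt_ext (V:=R_CompleteNormedModule) _ (fun _ => 0)) by (intros; apply Rmult_0_r).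
    rewrite (RInt_const (V:=R_CompleteNormedModule)). apply Rmult_0_r. }
  rewrite H0 in H. fold (wallis (S (S n))) (wallis n) in H.
  assert (0 < INR (S (S n))) by (apply lt_0_INR; lia).
  apply Rmult_eq_reg_l with (INR (S (S n))); lra.
Qed.

Lemma wallis_one : wallis 1 = 1.
Proof.
  unfold wallis, cos_moment. apply (@is_RInt_unique R_CompleteNormedModule).
  replace 1 with (minus (sin (PI / 2)) (sin 0)) at 1
    by (rewrite sin_PI2, sin_0; unfold minus, plus, opp; simpl; ring).
  apply (is_RInt_ext (V:=R_NormedModule)) with cos.
  { intros t _. simpl. ring. }
  apply (is_RInt_derive (V:=R_CompleteNormedModule)).
  - intros t _. apply is_derive_sin.
  - intros t _. apply (@ex_derive_continuous R_AbsRing R_NormedModule). eexists. apply is_derive_cos.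
Qed.

Lemma wallis_odd_pos (m : nat) : 0 < wallis (S (2 * m)).
Proof.
  induction m as [|m IH]; [change (0 < wallis 1); rewrite wallis_one; lra|].
  replace (S (2 * S m)) with (S (S (S (2 * m)))) by lia.
  pose proof (wallis_step (S (2 * m))) as H.
  assert (0 < INR (S (S (S (2 * m))))) by (apply lt_0_INR; lia).
  assert (0 < INR (S (S (2 * m)))) by (apply lt_0_INR; lia).
  apply Rmult_lt_reg_l with (INR (S (S (S (2 * m))))); [assumption|].
  rewrite H, Rmult_0_r. now apply Rmult_lt_0_compat.
Qed.

(** From sin t >= t - t^3/6 and t <= 2, since 1 - 4/6 = 1/3. *)
Lemma sin_ge_third (t : R) : 0 <= t <= PI / 2 -> t / 3 <= sin t.
Proof.
  intros Ht. pose proof PI_4. destruct (pre_sin_bound t 0 ltac:(lra) ltac:(lra)) as [H1 _].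
  unfold sin_approx, sin_term in H1. simpl in H1.
  assert (t * t * t <= t * 2 * 2) by (apply Rmult_le_compat; nra). nra.
Qed.

(* Since t <= 3 sin t on [0, pi/2], a deviation of size t^2 costs at most
   9 (wallis n - wallis (n+2)). *)
Lemma cos_moment_concentrates (g : R -> R) (g0 K : R) (m : nat) :
  (forall t, continuous g t) ->
  (forall t, 0 <= t <= PI / 2 -> Rabs (g t - g0) <= K * t ^ 2) -> 0 <= K ->
  Rabs (cos_moment g (S (2 * m)) / wallis (S (2 * m)) - g0) <= 9 * K * / INR (S m).
Proof.
  intros Hg HK HK0. set (n := S (2 * m)).
  pose proof PI_RGT_0 as HPI.
  pose proof (wallis_odd_pos m) as Hw. fold n in Hw.
  assert (H1 : Rabs (cos_moment g n - g0 * wallis n) <= 9 * K * (wallis n - wallis (S (S n)))).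
  { replace (cos_moment g n - g0 * wallis n) with (cos_moment (fun t => 1 * g t + (- g0) * 1) n)
      by (rewrite (cos_moment_lin g (fun _ => 1)); [unfold wallis; ring|assumption|intros; apply continuous_const]).
    assert (Hbd : is_RInt (fun t => 9 * K * (cos t ^ n * 1 - cos t ^ S (S n) * 1)) 0 (PI / 2)
      (9 * K * (wallis n - wallis (S (S n))))).
    { apply (is_RInt_scal (V:=R_NormedModule) (fun t => cos t ^ n * 1 - cos t ^ S (S n) * 1)).
      apply (is_RInt_minus (V:=R_NormedModule)); apply cos_moment_correct; intros; apply continuous_const. }
    assert (Hc : forall t, continuous (fun t => 1 * g t + - g0 * 1) t).
    { intros t. apply (continuous_plus (V:=R_NormedModule)); [|apply continuous_const].
      apply (continuous_scal_r (V:=R_NormedModule) 1 g). apply Hg. }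
    apply (norm_RInt_le (V:=R_NormedModule) (fun t => cos t ^ n * (1 * g t + - g0 * 1))
      (fun t => 9 * K * (cos t ^ n * 1 - cos t ^ S (S n) * 1)) 0 (PI / 2)); [lra| |now apply cos_moment_correct|exact Hbd].
    intros t Ht. change norm with Rabs.
    rewrite Rabs_mult. pose proof (cos_ge_0 t ltac:(lra) ltac:(lra)) as Hcos.
    assert (Hcn : 0 <= cos t ^ n) by now apply pow_le.
    rewrite (Rabs_right (cos t ^ n)) by lra.
    replace (9 * K * (cos t ^ n * 1 - cos t ^ S (S n) * 1)) with (cos t ^ n * (9 * K * (1 - cos t * cos t))) by (simpl; ring).
    apply Rmult_le_compat_l; [assumption|].
    replace (1 * g t + - g0 * 1) with (g t - g0) by ring.
    eapply Rle_trans; [now apply HK|].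
    pose proof (sin_ge_third t Ht) as Hs. pose proof (sin2_cos2 t) as Hsc. unfold Rsqr in Hsc.
    replace (1 - cos t * cos t) with (sin t * sin t) by lra.
    replace (9 * K * (sin t * sin t)) with (K * (9 * (sin t * sin t))) by ring.
    apply Rmult_le_compat_l; [assumption|]. nra. }
  replace (cos_moment g n / wallis n - g0) with ((cos_moment g n - g0 * wallis n) / wallis n) by (field; lra).
  unfold Rdiv. rewrite Rabs_mult, (Rabs_right (/ wallis n)) by (apply Rle_ge, Rlt_le, Rinv_0_lt_compat, Hw).
  apply Rmult_le_reg_r with (wallis n); [assumption|].
  rewrite Rmult_assoc, Rinv_l, Rmult_1_r by lra.
  eapply Rle_trans; [exact H1|]. rewrite (Rmult_assoc (9 * K)). apply Rmult_le_compat_l; [lra|].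
  pose proof (wallis_step n) as Hst.
  assert (Hm : 0 < INR (S m)) by (apply lt_0_INR; lia).
  assert (Hn : INR n = 2 * INR (S m) - 1).
  { unfold n. rewrite !S_INR, mult_INR. simpl (INR 2). ring. }
  rewrite (S_INR (S n)), (S_INR n), Hn in Hst.
  apply Rmult_le_reg_l with (INR (S m)); [assumption|].
  rewrite <- Rmult_assoc, Rinv_r, Rmult_1_l by lra.
  (* The recurrence gives w_n - w_(n+2) = w_n / (n+2), and n + 2 = 2m + 3 exceeds m + 1. *)
  assert (Hd : (2 * INR (S m) + 1) * (wallis n - wallis (S (S n))) = wallis n) by lra.
  assert (0 <= wallis n - wallis (S (S n))) by nra.
  nra.
Qed.

Lemma quadratic_bound (g g1 g2 : R -> R) (K : R) :
  (forall t, is_derive g t (g1 t)) -> (forall t, is_derive g1 t (g2 t)) -> g1 0 = 0 ->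
  (forall t, Rabs t <= 2 -> Rabs (g2 t) <= K) ->
  forall t, Rabs t <= 2 -> Rabs (g t - g 0) <= K * t ^ 2.
Proof.
  intros Hg Hg1 H0 HK t Ht.
  assert (HK0 : 0 <= K).
  { eapply Rle_trans; [apply Rabs_pos|apply (HK 0)]. rewrite Rabs_R0; lra. }
  assert (B1 : forall s, Rabs s <= 2 -> Rabs (g1 s) <= K * Rabs s).
  { intros s Hs. pose proof (bounded_variation g1 g2 K 0 s) as H.
    rewrite H0, !Rminus_0_r in H. apply H. intros r Hr.
    rewrite Rminus_0_r in Hr. split; [apply Hg1|apply HK; lra]. }
  pose proof (bounded_variation g g1 (K * Rabs t) 0 t) as H.
  rewrite Rminus_0_r in H. rewrite <- (pow2_abs t). replace (K * Rabs t ^ 2) with (K * Rabs t * Rabs t) by ring.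
  apply H. intros r Hr. rewrite Rminus_0_r in Hr. split; [apply Hg|].
  eapply Rle_trans; [apply B1; lra|]. apply Rmult_le_compat_l; assumption.
Qed.

(** [re_cos] and [im_cos] are the parts of cos(2 z t) with z = x + iy, as real functions of t that
    can be differentiated and integrated; at t = [PI / 2] they give cos(pi z). *)
Definition re_cos (x y t : R) : R :=
  (exp (- (2 * y * t)) * cos (2 * x * t) + exp (2 * y * t) * cos (2 * x * t)) / 2.
Definition im_cos (x y t : R) : R :=
  (exp (- (2 * y * t)) * sin (2 * x * t) - exp (2 * y * t) * sin (2 * x * t)) / 2.

Lemma Ccos_parts (x y : R) :
  Ccos (mkC x y * RtoC PI) = mkC (re_cos x y (PI / 2)) (im_cos x y (PI / 2)).
Proof.
  unfold Ccos, re_cos, im_cos.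
  replace (2 * x * (PI / 2)) with (x * PI) by field.
  replace (2 * y * (PI / 2)) with (y * PI) by field.
  apply Cx_ext; simpl;
    replace (0 * (x * PI - y * 0) - 1 * (x * 0 + y * PI)) with (- (y * PI)) by ring;
    replace (0 * (x * 0 + y * PI) + 1 * (x * PI - y * 0)) with (x * PI) by ring;
    rewrite Ropp_involutive, cos_neg, ?sin_neg; field.
Qed.

Section complex_cosine.
Variables x y : R.

(** [c1] and [s1] are the first derivatives. The second ones, [c2] and [s2], are written as the
    parts of -4 z^2 cos(2 z t), so that linearity of the moments merges the two real recurrences
    into one complex recurrence. *)
Let c1 (t : R) : R := ((- (2 * y) * exp (- (2 * y * t)) + 2 * y * exp (2 * y * t)) * cos (2 * x * t)
  - 2 * x * (exp (- (2 * y * t)) + exp (2 * y * t)) * sin (2 * x * t)) / 2.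
Let s1 (t : R) : R := ((- (2 * y) * exp (- (2 * y * t)) - 2 * y * exp (2 * y * t)) * sin (2 * x * t)
  + 2 * x * (exp (- (2 * y * t)) - exp (2 * y * t)) * cos (2 * x * t)) / 2.
Let c2 (t : R) : R := -4 * (x ^ 2 - y ^ 2) * re_cos x y t + 4 * (2 * x * y) * im_cos x y t.
Let s2 (t : R) : R := -4 * (x ^ 2 - y ^ 2) * im_cos x y t + -4 * (2 * x * y) * re_cos x y t.

Lemma derive_re_cos (t : R) : is_derive (re_cos x y) t (c1 t).
Proof. unfold re_cos, c1. auto_derive; [exact I|]. field. Qed.
Lemma derive_im_cos (t : R) : is_derive (im_cos x y) t (s1 t).
Proof. unfold im_cos, s1. auto_derive; [exact I|]. field. Qed.
Lemma derive_c1 (t : R) : is_derive c1 t (c2 t).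
Proof. unfold c1, c2, re_cos, im_cos. auto_derive; [exact I|]. field. Qed.
Lemma derive_s1 (t : R) : is_derive s1 t (s2 t).
Proof. unfold s1, s2, re_cos, im_cos. auto_derive; [exact I|]. field. Qed.

Lemma continuous_re_cos (t : R) : continuous (re_cos x y) t.
Proof. apply (@ex_derive_continuous R_AbsRing R_NormedModule). eexists; apply derive_re_cos. Qed.
Lemma continuous_im_cos (t : R) : continuous (im_cos x y) t.
Proof. apply (@ex_derive_continuous R_AbsRing R_NormedModule). eexists; apply derive_im_cos. Qed.
Lemma continuous_c2 (t : R) : continuous c2 t.
Proof.
  apply (continuous_plus (V:=R_NormedModule)); [apply (continuous_scal_r (V:=R_NormedModule) (-4 * (x ^ 2 - y ^ 2)) (re_cos x y))
    |apply (continuous_scal_r (V:=R_NormedModule) (4 * (2 * x * y)) (im_cos x y))]; auto using continuous_re_cos, continuous_im_cos.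
Qed.
Lemma continuous_s2 (t : R) : continuous s2 t.
Proof.
  apply (continuous_plus (V:=R_NormedModule)); [apply (continuous_scal_r (V:=R_NormedModule) (-4 * (x ^ 2 - y ^ 2)) (im_cos x y))
    |apply (continuous_scal_r (V:=R_NormedModule) (-4 * (2 * x * y)) (re_cos x y))]; auto using continuous_re_cos, continuous_im_cos.
Qed.
Lemma c1_0 : c1 0 = 0.
Proof. unfold c1. rewrite !Rmult_0_r, Ropp_0, sin_0. field. Qed.
Lemma s1_0 : s1 0 = 0.
Proof. unfold s1. rewrite !Rmult_0_r, Ropp_0, sin_0. field. Qed.

Definition cos_moment_C (n : nat) : Cx := mkC (cos_moment (re_cos x y) n) (cos_moment (im_cos x y) n).

Lemma cos_moment_C_one :
  ((Cone - RtoC 4 * mkC x y * mkC x y) * cos_moment_C 1)%Cx = Ccos (mkC x y * RtoC PI).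
Proof.
  rewrite Ccos_parts.
  rewrite <- (cos_moment_one (re_cos x y) c1 c2 derive_re_cos derive_c1 continuous_c2 c1_0).
  rewrite <- (cos_moment_one (im_cos x y) s1 s2 derive_im_cos derive_s1 continuous_s2 s1_0).
  unfold c2, s2.
  rewrite !cos_moment_lin by auto using continuous_re_cos, continuous_im_cos.
  apply Cx_ext; simpl; ring.
Qed.

Lemma cos_moment_C_step (n : nat) :
  ((INC (S (S n)) * INC (S (S n)) - RtoC 4 * mkC x y * mkC x y) * cos_moment_C (S (S n)))%Cx
  = (INC (S (S n)) * INC (S n) * cos_moment_C n)%Cx.
Proof.
  pose proof (cos_moment_step (re_cos x y) c1 c2 derive_re_cos derive_c1 continuous_c2 c1_0 n) as H1.
  pose proof (cos_moment_step (im_cos x y) s1 s2 derive_im_cos derive_s1 continuous_s2 s1_0 n) as H2.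
  unfold c2, s2 in H1, H2.
  rewrite cos_moment_lin in H1, H2 by auto using continuous_re_cos, continuous_im_cos.
  set (N := INR (S (S n))) in *. set (N1 := INR (S n)) in *.
  apply Cx_ext; unfold cos_moment_C; cbn [Re Im Cmul Csub Cadd Copp RtoC]; lra.
Qed.

Lemma parts_cos_bound (t : R) : Rabs t <= 2 ->
  Rabs (re_cos x y t) <= exp (4 * Rabs y) /\ Rabs (im_cos x y t) <= exp (4 * Rabs y).
Proof.
  intros Ht.
  assert (Hb : Rabs (2 * y * t) <= 4 * Rabs y).
  { rewrite !Rabs_mult, (Rabs_right 2) by lra. pose proof (Rabs_pos y). nra. }
  apply Rabs_le_between in Hb.
  assert (HE : forall u, u <= 4 * Rabs y -> exp u <= exp (4 * Rabs y)).
  { intros u [Hu|Hu]; [left; now apply exp_increasing|right; now rewrite Hu]. }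
  pose proof (HE (2 * y * t) ltac:(lra)). pose proof (HE (- (2 * y * t)) ltac:(lra)).
  pose proof (exp_pos (2 * y * t)). pose proof (exp_pos (- (2 * y * t))).
  pose proof (COS_bound (2 * x * t)). pose proof (SIN_bound (2 * x * t)).
  unfold re_cos, im_cos. split; apply Rabs_le_between; split; nra.
Qed.

(** High powers of the cosine concentrate at t = 0, where cos(2 z t) is 1 with vanishing derivative.
    The constant [K] bounds both second derivatives for |t| <= 2, which covers [0, PI/2]. *)
Lemma cos_moment_C_ratio_cv :
  Cseq_cv (fun m => cos_moment_C (S (2 * m)) / RtoC (wallis (S (2 * m))))%Cx Cone.
Proof.
  set (B := exp (4 * Rabs y)).
  set (K := (4 * Rabs (x ^ 2 - y ^ 2) + 4 * Rabs (2 * x * y)) * B).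
  assert (HB : 0 < B) by apply exp_pos.
  pose proof (Rabs_pos (x ^ 2 - y ^ 2)) as P1'. pose proof (Rabs_pos (2 * x * y)) as P2'.
  assert (HK0 : 0 <= K) by (unfold K; nra).
  assert (HA : forall p q u w, Rabs u <= B -> Rabs w <= B -> Rabs p <= 4 * Rabs (x ^ 2 - y ^ 2) ->
    Rabs q <= 4 * Rabs (2 * x * y) -> Rabs (p * u + q * w) <= K).
  { intros p q u w Hu Hw Hp Hq. eapply Rle_trans; [apply Rabs_triang|]. rewrite !Rabs_mult.
    unfold K. rewrite Rmult_plus_distr_r.
    apply Rplus_le_compat; apply Rmult_le_compat; auto using Rabs_pos. }
  assert (P1 : Rabs (-4 * (x ^ 2 - y ^ 2)) <= 4 * Rabs (x ^ 2 - y ^ 2)).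
  { rewrite Rabs_mult, (Rabs_left (-4)) by lra. lra. }
  assert (P2 : Rabs (-4 * (2 * x * y)) <= 4 * Rabs (2 * x * y)).
  { rewrite Rabs_mult, (Rabs_left (-4)) by lra. lra. }
  assert (P3 : Rabs (4 * (2 * x * y)) <= 4 * Rabs (2 * x * y)).
  { rewrite Rabs_mult, (Rabs_right 4) by lra. lra. }
  assert (Hc2 : forall t, Rabs t <= 2 -> Rabs (c2 t) <= K).
  { intros t Ht. destruct (parts_cos_bound t Ht). now apply HA. }
  assert (Hs2 : forall t, Rabs t <= 2 -> Rabs (s2 t) <= K).
  { intros t Ht. destruct (parts_cos_bound t Ht). now apply HA. }
  assert (HPI : forall t, 0 <= t <= PI / 2 -> Rabs t <= 2).
  { intros t Ht. pose proof PI_4. rewrite Rabs_right; lra. }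
  pose proof (quadratic_bound _ _ _ K derive_re_cos derive_c1 c1_0 Hc2) as Qc.
  pose proof (quadratic_bound _ _ _ K derive_im_cos derive_s1 s1_0 Hs2) as Qs.
  replace (re_cos x y 0) with 1 in Qc by (unfold re_cos; rewrite !Rmult_0_r, Ropp_0, exp_0, cos_0; field).
  replace (im_cos x y 0) with 0 in Qs by (unfold im_cos; rewrite !Rmult_0_r, Ropp_0, exp_0, sin_0; field).
  apply (Cseq_cv_squeeze _ _ (fun m => 9 * K * / INR (S m) + 9 * K * / INR (S m))).
  - exists 0%nat. intros m _. pose proof (wallis_odd_pos m) as Hw.
    eapply Rle_trans; [apply Cnorm_le_abs|].
    unfold Cdiv.
    rewrite <- RtoC_inv by lra.
    apply Rplus_le_compat.
    + replace (Re _) with (cos_moment (re_cos x y) (S (2 * m)) / wallis (S (2 * m)) - 1)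
        by (cbn -[Nat.mul]; unfold Rdiv; ring).
      apply cos_moment_concentrates; auto using continuous_re_cos.
    + replace (Im _) with (cos_moment (im_cos x y) (S (2 * m)) / wallis (S (2 * m)) - 0)
        by (cbn -[Nat.mul]; unfold Rdiv; ring).
      apply cos_moment_concentrates; auto using continuous_im_cos.
  - replace (Finite 0) with (Finite (9 * K * 0 + 9 * K * 0)) by (f_equal; ring).
    assert (H0 : is_lim_seq (fun m => 9 * K * / INR (S m)) (9 * K * 0)).
    { apply is_lim_seq_mult'; [apply is_lim_seq_const|].
      apply (is_lim_seq_incr_1 (fun m => / INR m)).
      apply (is_lim_seq_inv _ p_infty); [apply is_lim_seq_INR|discriminate]. }
    now apply is_lim_seq_plus'.
Qed.
End complex_cosine.

Fixpoint Cprod (f : nat -> Cx) (n : nat) : Cx :=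
  match n with O => Cone | S m => (Cprod f m * f m)%Cx end.

Definition cos_factor (z : Cx) (k : nat) : Cx :=
  (Cone - z * z / ((INC k + Cone / RtoC 2) * (INC k + Cone / RtoC 2)))%Cx.

Lemma half_shift_neq0 (k : nat) : (INC k + Cone / RtoC 2)%Cx <> Czero.
Proof.
  unfold Cone. rewrite <- RtoC_div, <- RtoC_add by lra. apply RtoC_neq0.
  pose proof (pos_INR k). lra.
Qed.

(** An exact identity for every [m], obtained by unrolling the moment recurrence along odd indices
    2m + 1, where n + 2 is twice a half-integer. Besides the limit it shows that no factor vanishes
    where the cosine does not. *)
Lemma Ccos_partial_product (x y : R) (m : nat) :
  Ccos (mkC x y * RtoC PI) =
  (Cprod (cos_factor (mkC x y)) (S m) * (cos_moment_C x y (S (2 * m)) / RtoC (wallis (S (2 * m)))))%Cx.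
Proof.
  set (z := mkC x y). induction m as [|m IH].
  - change (S (2 * 0)) with 1%nat. rewrite wallis_one.
    transitivity ((Cone - RtoC 4 * z * z) * cos_moment_C x y 1)%Cx; [symmetry; apply cos_moment_C_one|].
    simpl Cprod.
    unfold cos_factor. change (INC 0) with Czero. fold Cone. field.
  - rewrite IH. change (Cprod (cos_factor z) (S (S m))) with (Cprod (cos_factor z) (S m) * cos_factor z (S m))%Cx.
    pose proof (cos_moment_C_step x y (S (2 * m))) as Hs. fold z in Hs.
    pose proof (wallis_step (S (2 * m))) as Hw.
    pose proof (wallis_odd_pos m) as Hp. pose proof (wallis_odd_pos (S m)) as Hp'.
    replace (S (2 * S m)) with (S (S (S (2 * m)))) in * by lia.
    set (n := S (2 * m)) in *.
    assert (E1 : INC (S (S n)) = (RtoC 2 * (INC (S m) + Cone / RtoC 2))%Cx).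
    { unfold n. apply Cx_ext; [|simpl; field]. rewrite !S_INR, mult_INR. simpl. field. }
    assert (Hn : INC (S (S n)) <> Czero) by apply INC_S_neq0.
    assert (Hn1 : INC (S n) <> Czero) by apply INC_S_neq0.
    apply (f_equal RtoC) in Hw. rewrite !RtoC_mul in Hw.
    assert (Hw0 : RtoC (wallis n) <> Czero) by (apply RtoC_neq0; lra).
    assert (Hw0' : RtoC (wallis (S (S n))) <> Czero) by (apply RtoC_neq0; lra).
    assert (Ef : cos_factor z (S m) = ((INC (S (S n)) * INC (S (S n)) - RtoC 4 * z * z) / (INC (S (S n)) * INC (S (S n))))%Cx).
    { rewrite E1. unfold cos_factor. pose proof (half_shift_neq0 (S m)) as Hh.
      set (h := (INC (S m) + Cone / RtoC 2)%Cx) in *. field. exact Hh. }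
    rewrite Ef.
    transitivity (Cprod (cos_factor z) (S m) *
      (((INC (S (S n)) * INC (S (S n)) - RtoC 4 * z * z) * cos_moment_C x y (S (S n))) / (INC (S (S n)) * (INC (S (S n)) * RtoC (wallis (S (S n)))))))%Cx;
      [rewrite Hs, Hw|]; field; auto.
Qed.

Lemma Ccos_product_cv (z : Cx) : Cseq_cv (Cprod (cos_factor z)) (Ccos (z * RtoC PI)).
Proof.
  destruct z as [x y]. apply (Cseq_cv_incr_n _ 1).
  pose proof (cos_moment_C_ratio_cv x y) as Hr.
  assert (H1 : Cone <> Czero) by apply (F_1_neq_0 Cx_field_theory).
  replace (Ccos (mkC x y * RtoC PI)) with (Ccos (mkC x y * RtoC PI) / Cone)%Cx by (field; assumption).
  (* From [N] on the remainder is within 1/2 of 1, hence nonzero, and the partial product is the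
     cosine divided by it. *)
  destruct (Hr (1/2) ltac:(lra)) as [N HN].
  eapply Cseq_cv_ext_loc with (N := N); [|exact (Cseq_cv_div _ _ _ _ H1 (Cseq_cv_const _) Hr)].
  intros n Hn. replace (n + 1)%nat with (S n) by lia. cbv beta.
  rewrite (Ccos_partial_product x y n) at 1.
  assert (H0 : (cos_moment_C x y (S (2 * n)) / RtoC (wallis (S (2 * n))))%Cx <> Czero).
  { intros E. specialize (HN n Hn). cbv beta in HN. rewrite E in HN.
    replace (Czero - Cone)%Cx with (RtoC (-1)) in HN by ring.
    rewrite Cnorm_RtoC, Rabs_left in HN by lra. lra. }
  set (q := (cos_moment_C x y (S (2 * n)) / RtoC (wallis (S (2 * n))))%Cx) in *.
  field. exact H0.
Qed.

(** * Partial fractions *)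

Lemma Csum_ext (f g : nat -> Cx) (N : nat) :
  (forall n, (n <= N)%nat -> f n = g n) -> Csum f N = Csum g N.
Proof.
  induction N as [|N IH]; intros H; simpl; [now apply H|].
  rewrite IH, H by auto. reflexivity.
Qed.

Lemma Csum_add (f g : nat -> Cx) (N : nat) :
  Csum (fun n => f n + g n)%Cx N = (Csum f N + Csum g N)%Cx.
Proof. induction N as [|N IH]; simpl; [reflexivity|rewrite IH; ring]. Qed.

Lemma Csum_scal (k : Cx) (f : nat -> Cx) (N : nat) :
  Csum (fun n => k * f n)%Cx N = (k * Csum f N)%Cx.
Proof. induction N as [|N IH]; simpl; [reflexivity|rewrite IH; ring]. Qed.

Lemma Cprod_ext (f g : nat -> Cx) (n : nat) :
  (forall k, (k < n)%nat -> f k = g k) -> Cprod f n = Cprod g n.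
Proof.
  induction n as [|n IH]; intros H; simpl; [reflexivity|].
  rewrite IH, H by auto. reflexivity.
Qed.

Lemma Cprod_mul (f g : nat -> Cx) (n : nat) :
  Cprod (fun k => f k * g k)%Cx n = (Cprod f n * Cprod g n)%Cx.
Proof. induction n as [|n IH]; simpl; [ring|rewrite IH; ring]. Qed.

Lemma Cprod_neq0 (f : nat -> Cx) (n : nat) :
  (forall k, (k < n)%nat -> f k <> Czero) -> Cprod f n <> Czero.
Proof.
  induction n as [|n IH]; intros H; simpl; [apply (F_1_neq_0 Cx_field_theory)|].
  apply Cmul_neq0; auto.
Qed.

Section partial_fractions.
Variables c X : nat -> Cx.
Hypothesis Xinj : forall m n, m <> n -> (X m - X n)%Cx <> Czero.

Definition pf_quotient (N : nat) (y : Cx) : Cx :=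
  (Cprod (fun k => c k - y) (S (S N)) / Cprod (fun n => X n - y) (S N))%Cx.

(** The product over m <> n is split into m < n and n < m <= N, because the two pieces change
    differently when n is raised by one. *)
Definition pf_residue (N n : nat) : Cx :=
  (Cprod (fun k => c k - X n) (S (S N)) /
   (Cprod (fun m => X m - X n) n * Cprod (fun m => X (n + 1 + m)%nat - X n) (N - n)))%Cx.

Lemma pf_residue_S (N n : nat) : (n <= N)%nat ->
  pf_residue (S N) n = (pf_residue N n * (c (S (S N)) - X n) / (X (S N) - X n))%Cx.
Proof.
  intros Hn. unfold pf_residue.
  replace (S N - n)%nat with (S (N - n)) by lia.
  change (Cprod (fun k => c k - X n)%Cx (S (S (S N)))) with
    (Cprod (fun k => c k - X n) (S (S N)) * (c (S (S N)) - X n))%Cx.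
  change (Cprod (fun m => X (n + 1 + m)%nat - X n)%Cx (S (N - n))) with
    (Cprod (fun m => X (n + 1 + m)%nat - X n) (N - n) * (X (n + 1 + (N - n))%nat - X n))%Cx.
  replace (n + 1 + (N - n))%nat with (S N) by lia.
  field. repeat split; try (apply Cprod_neq0; intros k Hk); apply Xinj; lia.
Qed.

(** The newest residue is expressed through the previous quotient at the new node, so that the
    induction hypothesis can be applied there too. *)
Lemma pf_residue_last (N : nat) :
  pf_residue (S N) (S N) = ((c (S (S N)) - X (S N)) * pf_quotient N (X (S N)))%Cx.
Proof.
  unfold pf_residue, pf_quotient. rewrite Nat.sub_diag.
  change (Cprod (fun k => c k - X (S N))%Cx (S (S (S N)))) with
    (Cprod (fun k => c k - X (S N)) (S (S N)) * (c (S (S N)) - X (S N)))%Cx.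
  simpl (Cprod _ 0). field.
  apply Cprod_neq0. intros k Hk. apply Xinj. lia.
Qed.

(** Passing to N + 1 multiplies by (c - y)/(X - y), with c and X the new zero and node. The
    expansion for N is used both at [y] and at the new node. The constant [kappa] stays existential
    because it cancels when two values are subtracted. *)
Lemma partial_fractions (N : nat) : exists kappa, forall y,
  (forall n, (n <= N)%nat -> (X n - y)%Cx <> Czero) ->
  pf_quotient N y = (kappa - y + Csum (fun n => pf_residue N n / (X n - y)) N)%Cx.
Proof.
  induction N as [|N [kappa IH]].
  - exists (c 0%nat + c 1%nat - X 0%nat)%Cx. intros y Hy.
    unfold pf_quotient, pf_residue; simpl. field. apply (Hy 0%nat). lia.
  - exists (kappa + c (S (S N)) - X (S N))%Cx. intros y Hy.
    assert (Hy' : (X (S N) - y)%Cx <> Czero) by (apply Hy; lia).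
    assert (EQ : pf_quotient (S N) y = (pf_quotient N y * (c (S (S N)) - y) / (X (S N) - y))%Cx).
    { unfold pf_quotient.
      change (Cprod (fun k => c k - y)%Cx (S (S (S N)))) with
        (Cprod (fun k => c k - y) (S (S N)) * (c (S (S N)) - y))%Cx.
      change (Cprod (fun k => X k - y)%Cx (S (S N))) with
        (Cprod (fun k => X k - y) (S N) * (X (S N) - y))%Cx.
      field. split; try assumption; apply Cprod_neq0; intros k Hk; apply Hy; lia. }
    rewrite EQ, IH by (intros; apply Hy; lia).
    change (Csum (fun n => pf_residue (S N) n / (X n - y))%Cx (S N)) with
      (Csum (fun n => pf_residue (S N) n / (X n - y)) N + pf_residue (S N) (S N) / (X (S N) - y))%Cx.
    rewrite pf_residue_last, (IH (X (S N))) by (intros; apply Xinj; lia).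
    (* Term by term, (c - y)/((X - y)(X_n - y)) is split at its two poles y = X_n and y = X. *)
    assert (ES : (Csum (fun n => pf_residue (S N) n / (X n - y)) N +
        (c (S (S N)) - X (S N)) / (X (S N) - y) * Csum (fun n => pf_residue N n / (X n - X (S N))) N
      = (c (S (S N)) - y) / (X (S N) - y) * Csum (fun n => pf_residue N n / (X n - y)) N)%Cx).
    { rewrite <- !Csum_scal, <- Csum_add. apply Csum_ext. intros n Hn.
      rewrite pf_residue_S by assumption.
      field. repeat split; first [assumption|apply Hy; lia|apply Xinj; lia]. }
    set (S1 := Csum (fun n => pf_residue N n / (X n - y))%Cx N) in *.
    set (S2 := Csum (fun n => pf_residue N n / (X n - X (S N)))%Cx N) in *.
    set (S3 := Csum (fun n => pf_residue (S N) n / (X n - y))%Cx N) in *.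
    replace ((kappa - y + S1) * (c (S (S N)) - y) / (X (S N) - y))%Cx with
      ((kappa - y) * (c (S (S N)) - y) / (X (S N) - y) + (c (S (S N)) - y) / (X (S N) - y) * S1)%Cx
      by (field; assumption).
    rewrite <- ES. field. assumption.
Qed.
End partial_fractions.

(** * Residues for the squared zeros of cos(pi z) and the squared points v/2 + n *)

Definition half_sqr (k : nat) : Cx := ((INC k + Cone / RtoC 2) * (INC k + Cone / RtoC 2))%Cx.
Definition node (v : Cx) (n : nat) : Cx := ((v / RtoC 2 + INC n) * (v / RtoC 2 + INC n))%Cx.

Lemma node_sub (v : Cx) (m n : nat) :
  (node v m - node v n)%Cx = ((INC m - INC n) * (v + INC m + INC n))%Cx.
Proof. unfold node. field. Qed.

Lemma node_sub_neq0 (v : Cx) (m n : nat) : notZ0neg v -> m <> n ->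
  (node v m - node v n)%Cx <> Czero.
Proof.
  intros Hv Hmn. rewrite node_sub. apply Cmul_neq0.
  - apply Csub_neq0. intros E. now apply Hmn, INR_eq, RtoC_inj.
  - replace (v + INC m + INC n)%Cx with (v + INC (m + n))%Cx by (rewrite plus_INR, RtoC_add; ring).
    now apply add_INC_neq0.
Qed.

(** With x = v/2 + n, each factor is (k + 1/2 - x)(k + 1/2 + x). Raising x by one shifts both linear
    products by one place, so that they telescope to their end factors. Without division, the
    induction needs no nonvanishing condition. *)
Lemma numerator_step (v : Cx) (n M : nat) :
  (Cprod (fun k => half_sqr k - node v (S n)) M * (INC M - Cone / RtoC 2 - (v / RtoC 2 + INC n)))%Cx =
  (- (Cprod (fun k => half_sqr k - node v n) M * (INC M + Cone / RtoC 2 + (v / RtoC 2 + INC n))))%Cx.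
Proof.
  induction M as [|M IH].
  - simpl Cprod. change (INC 0) with Czero. field.
  - cbn [Cprod]. set (A := Cprod _ M) in *. set (B := Cprod _ M) in *.
    transitivity ((A * (INC M - Cone / RtoC 2 - (v / RtoC 2 + INC n))) *
       ((INC M + Cone / RtoC 2 - v / RtoC 2 - INC n) * (INC M + Cone / RtoC 2 + v / RtoC 2 + INC n + Cone)))%Cx.
    + unfold half_sqr, node. rewrite !INC_S. field.
    + rewrite IH. unfold half_sqr, node. rewrite !INC_S. field.
Qed.

(** The same telescoping for the factors (m - n)(v + m + n). *)
Lemma lower_step (v : Cx) (n j : nat) :
  (Cprod (fun m => node v m - node v (S n)) j * ((INC j - Cone - INC n) * (v + INC n)))%Cx =
  (Cprod (fun m => node v m - node v n) j * ((- Cone - INC n) * (v + INC n + INC j)))%Cx.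
Proof.
  induction j as [|j IH].
  - simpl Cprod. change (INC 0) with Czero. ring.
  - cbn [Cprod]. rewrite !node_sub. set (A := Cprod _ j) in *. set (B := Cprod _ j) in *.
    transitivity ((A * ((INC j - Cone - INC n) * (v + INC n))) *
       ((v + INC j + INC n + Cone) * (INC j - INC n)))%Cx.
    + rewrite !INC_S. ring.
    + rewrite IH, !INC_S. ring.
Qed.

(** Here the factors are (m + 1)(v + 2n + 1 + m): the first is unaffected by raising n and the
    second moves by two places. One factor fewer remains, since the last node is fixed. *)
Lemma upper_step (v : Cx) (n j : nat) :
  (Cprod (fun m => node v (n + 1 + m)%nat - node v n) (S j) * (v + RtoC 2 * INC n + INC j + RtoC 2))%Cx =
  ((INC j + Cone) * (v + RtoC 2 * INC n + Cone) * (v + RtoC 2 * INC n + RtoC 2) *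
    Cprod (fun m => node v (S n + 1 + m)%nat - node v (S n)) j)%Cx.
Proof.
  induction j as [|j IH].
  - simpl Cprod. rewrite node_sub, !plus_INR, !RtoC_add. change (INC 0) with Czero. change (INC 1) with Cone. ring.
  - change (Cprod (fun m => node v (n + 1 + m)%nat - node v n)%Cx (S (S j))) with
      (Cprod (fun m => node v (n + 1 + m)%nat - node v n) (S j) * (node v (n + 1 + S j)%nat - node v n))%Cx.
    change (Cprod (fun m => node v (S n + 1 + m)%nat - node v (S n))%Cx (S j)) with
      (Cprod (fun m => node v (S n + 1 + m)%nat - node v (S n)) j * (node v (S n + 1 + j)%nat - node v (S n)))%Cx.
    set (A := Cprod _ (S j)) in *. set (B := Cprod _ j) in *.
    transitivity ((A * (v + RtoC 2 * INC n + INC j + RtoC 2)) *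
      ((INC j + RtoC 2) * (v + RtoC 2 * INC n + INC j + RtoC 3)))%Cx.
    + rewrite node_sub, !plus_INR, !RtoC_add. change (INC 1) with Cone. rewrite !INC_S. ring.
    + rewrite IH, node_sub, !plus_INR, !RtoC_add. change (INC 1) with Cone. rewrite !INC_S. ring.
Qed.

(** Equals (v)_n (1 + v/2)_n / (n! (v/2)_n), the part of the hypergeometric term that is free of the
    sigmas. *)
Definition coef (v : Cx) (n : nat) : Cx :=
  (poch v n * (v + RtoC 2 * INC n) / (Cfact n * v))%Cx.

(** With k = (3-v)/2 this is (1 + k/(N+j+1+v)) (1 - k/(N-j+k)). The residue recurrence uses it for j
    < N. The 3 is due to the surplus numerator factor. *)
Definition weight_factor (v : Cx) (N j : nat) : Cx :=
  ((INC (N + j + 1) + v / RtoC 2 + RtoC 3 / RtoC 2) / (INC (N + j + 1) + v) *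
   (INC (N - j) / (INC (N - j) + (RtoC 3 - v) / RtoC 2)))%Cx.

Definition weight (v : Cx) (N n : nat) : Cx := Cprod (weight_factor v N) n.

Local Notation residue v := (pf_residue half_sqr (node v)).

Lemma neq0_of_Re_pos (z : Cx) : 0 < Re z -> z <> Czero.
Proof. intros H E. rewrite E in H. simpl in H. lra. Qed.

Lemma add_nat_half_neq0 (v : Cx) (n : nat) : Re v < 3 -> (INC n + (RtoC 3 - v) / RtoC 2)%Cx <> Czero.
Proof.
  intros Hv. apply neq0_of_Re_pos. pose proof (pos_INR n).
  replace (Re _) with (INR n + (3 - Re v) / 2) by (simpl; field). lra.
Qed.

Lemma notZ0neg_neq0 (v : Cx) : notZ0neg v -> v <> Czero.
Proof. intros Hv E. apply (Hv 0%nat). rewrite E. simpl. now rewrite Ropp_0. Qed.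

(** The side conditions of [field] come with halves and signs cleared, so each is a known nonzero
    quantity up to a factor 1, 2 or -1. *)
Ltac neq0_of Z k :=
  let E := fresh in intro E; apply Z;
  match type of E with ?e = _ =>
    transitivity (k * e)%Cx; [unfold IZC; field|rewrite E; ring] end.
Ltac neq0_scaled := solve [assumption |
  match goal with Z : _ <> Czero |- _ =>
    first [neq0_of Z Cone | neq0_of Z (Cone / RtoC 2)%Cx | neq0_of Z (- Cone)%Cx] end].

Lemma residue_step (v : Cx) (N n : nat) : notZ0neg v -> Re v < 3 -> (n < N)%nat ->
  residue v N (S n) = (residue v N n * weight_factor v N n *
    ((v + INC n) * (v + RtoC 2 * INC n + RtoC 2) / ((INC n + Cone) * (v + RtoC 2 * INC n))))%Cx.
Proof.
  intros Hv Hv3 Hn. unfold pf_residue, weight_factor.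
  (* [j] counts the nodes above n + 1: the upper product has j + 1 factors at n and j factors at n +
     1. *)
  destruct (Nat.le_exists_sub (S n) N Hn) as [j [HN _]].
  replace (N - n)%nat with (S j) by lia. replace (N - S n)%nat with j by lia.
  pose proof (numerator_step v n (S (S N))) as H1.
  pose proof (lower_step v n n) as H2. pose proof (upper_step v n j) as H3.
  change (Cprod (fun m => node v m - node v (S n))%Cx (S n)) with
    (Cprod (fun m => node v m - node v (S n)) n * (node v n - node v (S n)))%Cx.
  assert (L0 : Cprod (fun m => node v m - node v n)%Cx n <> Czero).
  { apply Cprod_neq0. intros k Hk. apply node_sub_neq0; [assumption|lia]. }
  assert (L0' : Cprod (fun m => node v m - node v (S n))%Cx n <> Czero).
  { apply Cprod_neq0. intros k Hk. apply node_sub_neq0; [assumption|lia]. }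
  assert (U0 : Cprod (fun m => node v (n + 1 + m)%nat - node v n)%Cx (S j) <> Czero).
  { apply Cprod_neq0. intros k Hk. apply node_sub_neq0; [assumption|lia]. }
  assert (U0' : Cprod (fun m => node v (S n + 1 + m)%nat - node v (S n))%Cx j <> Czero).
  { apply Cprod_neq0. intros k Hk. apply node_sub_neq0; [assumption|lia]. }
  pose proof (add_nat_half_neq0 v (S j) Hv3) as Z1.
  pose proof (add_INC_neq0 v n Hv) as Z2.
  pose proof (add_INC_neq0 v (n + n) Hv) as Z3.
  pose proof (add_INC_neq0 v (S (n + n)) Hv) as Z4.
  pose proof (add_INC_neq0 v (S (S (n + n))) Hv) as Z5.
  pose proof (add_INC_neq0 v (N + n + 1) Hv) as Z6.
  pose proof (INC_S_neq0 n) as Z7. pose proof (INC_S_neq0 j) as Z8.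
  rewrite node_sub. subst N.
  set (A' := Cprod (fun k => half_sqr k - node v (S n))%Cx _) in *.
  set (A := Cprod (fun k => half_sqr k - node v n)%Cx _) in *.
  set (L' := Cprod (fun m => node v m - node v (S n))%Cx n) in *.
  set (L := Cprod (fun m => node v m - node v n)%Cx n) in *.
  set (U := Cprod _ (S j)) in *. set (U' := Cprod _ j) in *.
  rewrite ?plus_INR, ?RtoC_add in *. change (INC 1) with Cone in *.
  rewrite ?INC_S, ?plus_INR, ?RtoC_add, ?INC_S in *.
  set (x := INC n) in *. set (z := INC j) in *.
  assert (EA : A' = (- (A * (z + x + RtoC 7 / RtoC 2 + v / RtoC 2 + x)) / (z + Cone + (RtoC 3 - v) / RtoC 2))%Cx).
  { transitivity ((A' * (z + (x + Cone) + Cone + Cone - Cone / RtoC 2 - (v / RtoC 2 + x))) / (z + Cone + (RtoC 3 - v) / RtoC 2))%Cx.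
    - field. neq0_scaled.
    - rewrite H1. field. neq0_scaled. }
  assert (EL : L' = (L * ((x + Cone) * (v + x + x)) / (v + x))%Cx).
  { transitivity (- (L' * ((x - Cone - x) * (v + x))) / (v + x))%Cx.
    - field. neq0_scaled.
    - rewrite H2. field. neq0_scaled. }
  assert (EU : U' = (U * (v + RtoC 2 * x + z + RtoC 2) / ((z + Cone) * (v + RtoC 2 * x + Cone) * (v + RtoC 2 * x + RtoC 2)))%Cx).
  { rewrite H3. field. repeat split; neq0_scaled. }
  pose proof (F_1_neq_0 Cx_field_theory) as Z0.
  rewrite EA, EL, EU. field. repeat split; neq0_scaled.
Qed.

Lemma residue_closed_form (v : Cx) (N n : nat) : notZ0neg v -> Re v < 3 -> (n <= N)%nat ->
  residue v N n = (residue v N 0 * (weight v N n * coef v n))%Cx.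
Proof.
  intros Hv Hv3. pose proof (notZ0neg_neq0 v Hv) as Z0.
  induction n as [|n IH]; intros Hn.
  - unfold weight, coef. simpl. unfold Cfact. simpl. change (RtoC 1) with Cone. field.
    assumption.
  - rewrite residue_step, IH by (auto; lia).
    change (weight v N (S n)) with (weight v N n * weight_factor v N n)%Cx.
    unfold coef. rewrite Cfact_S, INC_S. simpl poch.
    pose proof (Cfact_neq0 n) as Z1. pose proof (INC_S_neq0 n) as Z2.
    pose proof (add_INC_neq0 v (n + n) Hv) as Z3.
    rewrite plus_INR, RtoC_add in Z3. rewrite INC_S in Z2.
    field. repeat split; neq0_scaled.
Qed.

(** Subtraction removes [kappa] and leaves -(y - y') from the polynomial part; after division by y -
    y' this is the last term, [/ residue v N 0]. *)
Lemma weighted_sum_eq (v y y' : Cx) (N : nat) : notZ0neg v -> Re v < 3 ->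
  (forall n, (node v n - y)%Cx <> Czero) -> (forall n, (node v n - y')%Cx <> Czero) ->
  (y - y')%Cx <> Czero -> residue v N 0 <> Czero ->
  Csum (fun n => weight v N n * (coef v n / ((node v n - y) * (node v n - y'))))%Cx N =
  ((pf_quotient half_sqr (node v) N y / residue v N 0
    - pf_quotient half_sqr (node v) N y' / residue v N 0) / (y - y') + / residue v N 0)%Cx.
Proof.
  intros Hv Hv3 Hy Hy' Hyy HR.
  destruct (partial_fractions half_sqr (node v) (fun m n => node_sub_neq0 v m n Hv) N) as [kappa Hk].
  rewrite (Hk y) by auto. rewrite (Hk y') by auto.
  rewrite (Csum_ext _ (fun n => (/ ((y - y') * residue v N 0)) *
    (residue v N n / (node v n - y) + (- Cone) * (residue v N n / (node v n - y'))))%Cx).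
  - rewrite Csum_scal, Csum_add, Csum_scal. field. auto.
  - intros n Hn. rewrite (residue_closed_form v N n) by assumption.
    specialize (Hy n). specialize (Hy' n). field. auto.
Qed.

(** * Limits and dominated convergence *)

Lemma Cprod_half_sqr (M : nat) :
  Cprod half_sqr M = (poch (Cone / RtoC 2) M * poch (Cone / RtoC 2) M)%Cx.
Proof. induction M as [|M IH]; simpl; [ring|rewrite IH; unfold half_sqr; ring]. Qed.

Lemma Cprod_half_sqr_sub (z : Cx) (M : nat) :
  Cprod (fun k => half_sqr k - z * z)%Cx M = (Cprod half_sqr M * Cprod (cos_factor z) M)%Cx.
Proof.
  rewrite <- Cprod_mul. apply Cprod_ext. intros k _. unfold half_sqr, cos_factor.
  pose proof (half_shift_neq0 k) as H. set (h := (INC k + Cone / RtoC 2)%Cx) in *. field. exact H.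
Qed.

Lemma node_sub_sqr (v z : Cx) (n : nat) :
  (node v n - z * z)%Cx = ((v / RtoC 2 - z + INC n) * (v / RtoC 2 + z + INC n))%Cx.
Proof. unfold node. ring. Qed.

Lemma Cprod_node_sub_sqr (v z : Cx) (M : nat) :
  Cprod (fun n => node v n - z * z)%Cx M = (poch (v / RtoC 2 - z) M * poch (v / RtoC 2 + z) M)%Cx.
Proof. induction M as [|M IH]; simpl; [ring|rewrite IH, node_sub_sqr; ring]. Qed.

(** Since node 0 is (v/2)^2, the numerator is a cosine product at v/2. The node differences are m (v
    + m) for m = 1, ..., N, and multiplication by v supplies the missing first factor of
    (v)_(N+1). *)
Lemma residue0_eq (v : Cx) (N : nat) : notZ0neg v ->
  residue v N 0 = (Cprod half_sqr (S (S N)) * Cprod (cos_factor (v / RtoC 2)) (S (S N)) * v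
    / (Cfact N * poch v (S N)))%Cx.
Proof.
  intros Hv. unfold pf_residue. rewrite Nat.sub_0_r.
  rewrite (Cprod_ext (fun k => half_sqr k - node v 0)%Cx
    (fun k => half_sqr k - v / RtoC 2 * (v / RtoC 2))%Cx)
    by (intros; unfold node; simpl (INR 0); field).
  rewrite Cprod_half_sqr_sub.
  assert (E : (Cprod (fun m => node v (0 + 1 + m)%nat - node v 0) N * v)%Cx = (Cfact N * poch v (S N))%Cx).
  { induction N as [|N IH].
    - unfold Cfact. simpl. change (RtoC 1) with Cone. change (RtoC 0) with Czero. ring.
    - change (poch v (S (S N))) with (poch v (S N) * (v + INC (S N)))%Cx.
      change (Cprod (fun m => node v (0 + 1 + m)%nat - node v 0)%Cx (S N)) with
       (Cprod (fun m => node v (0 + 1 + m)%nat - node v 0) N * (node v (S N) - node v 0))%Cx.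
      rewrite Cfact_S, node_sub, INC_S. change (INC 0) with Czero.
      transitivity ((Cprod (fun m => node v (0 + 1 + m)%nat - node v 0) N * v) * ((INC N + Cone) * (v + (INC N + Cone))))%Cx; [ring|].
      rewrite IH. ring. }
  rewrite <- E. simpl (Cprod _ 0). field. split; [now apply notZ0neg_neq0|].
  apply Cprod_neq0. intros k Hk. apply node_sub_neq0; [assumption|lia].
Qed.

Lemma Cnpow_add (n : nat) (z w : Cx) : Cnpow n (z + w) = (Cnpow n z * Cnpow n w)%Cx.
Proof. unfold Cnpow. rewrite <- Cexp_add. f_equal. ring. Qed.

Lemma half_notZ0neg : notZ0neg (Cone / RtoC 2).
Proof.
  intros k H. apply (half_shift_neq0 k). rewrite H, RtoC_opp. ring.
Qed.

(** The nodes 0, ..., N give exactly the N + 1 factors in each of Gauss' denominators. The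
    half-integer products cancel, and so do the powers, because (v/2 - z) + (v/2 + z) = v. *)
Lemma quotient_ratio_eq (v z : Cx) (N : nat) : notZ0neg v ->
  notZ0neg (v / RtoC 2 - z) -> notZ0neg (v / RtoC 2 + z) ->
  Cprod (cos_factor (v / RtoC 2)) (S (S N)) <> Czero ->
  (pf_quotient half_sqr (node v) N (z * z) / residue v N 0)%Cx =
  (Cprod (cos_factor z) (S (S N)) / Cprod (cos_factor (v / RtoC 2)) (S (S N)) *
   (gauss_seq (v / RtoC 2 - z) N * gauss_seq (v / RtoC 2 + z) N / (gauss_seq v N * v)))%Cx.
Proof.
  intros Hv H1 H2 HE. rewrite residue0_eq by assumption. unfold pf_quotient.
  rewrite Cprod_half_sqr_sub, Cprod_node_sub_sqr.
  assert (Ev : Cnpow N v = (Cnpow N (v / RtoC 2 - z) * Cnpow N (v / RtoC 2 + z))%Cx).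
  { rewrite <- Cnpow_add. f_equal. field. }
  unfold gauss_seq. rewrite Ev.
  assert (Hh : Cprod half_sqr (S (S N)) <> Czero).
  { rewrite Cprod_half_sqr. apply Cmul_neq0; apply poch_neq0, half_notZ0neg. }
  pose proof (poch_neq0 _ (S N) Hv). pose proof (poch_neq0 _ (S N) H1). pose proof (poch_neq0 _ (S N) H2).
  pose proof (notZ0neg_neq0 v Hv). pose proof (Cfact_neq0 N).
  assert (Cnpow N (v / RtoC 2 - z) <> Czero) by apply Cexp_neq0.
  assert (Cnpow N (v / RtoC 2 + z) <> Czero) by apply Cexp_neq0.
  set (A := Cprod half_sqr (S (S N))) in *. set (B := Cprod (cos_factor (v / RtoC 2)) (S (S N))) in *.
  set (C := Cprod (cos_factor z) (S (S N))) in *.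
  set (p := poch v (S N)) in *. set (q := poch _ (S N)) in *. set (r := poch _ (S N)) in *.
  set (e := Cnpow _ _) in *. set (e' := Cnpow _ _) in *. set (F := Cfact N) in *.
  field. repeat split; assumption.
Qed.

(** Gauss' sequence at 1/2 measures the products of half-integers and leaves N^(v-1). The surplus
    numerator factor contributes (N + 3/2)^2, which lowers the order to N^(v-3). *)
Lemma inv_residue0_eq (v : Cx) (N : nat) : notZ0neg v ->
  Cprod (cos_factor (v / RtoC 2)) (S (S N)) <> Czero ->
  (/ residue v N 0)%Cx =
  (Cnpow N (v - Cone) / ((INC N + RtoC 3 / RtoC 2) * (INC N + RtoC 3 / RtoC 2)) *
   (gauss_seq (Cone / RtoC 2) N * gauss_seq (Cone / RtoC 2) N
     / (gauss_seq v N * Cprod (cos_factor (v / RtoC 2)) (S (S N)) * v)))%Cx.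
Proof.
  intros Hv HE. rewrite residue0_eq, Cprod_half_sqr by assumption.
  change (poch (Cone / RtoC 2) (S (S N))) with (poch (Cone / RtoC 2) (S N) * (Cone / RtoC 2 + INC (S N)))%Cx.
  replace (Cone / RtoC 2 + INC (S N))%Cx with (INC N + RtoC 3 / RtoC 2)%Cx by (rewrite INC_S; field).
  assert (Ev : Cnpow N v = (Cnpow N (v - Cone) * (Cnpow N (Cone / RtoC 2) * Cnpow N (Cone / RtoC 2)))%Cx).
  { rewrite <- !Cnpow_add. f_equal. field. }
  unfold gauss_seq. rewrite Ev.
  pose proof (poch_neq0 _ (S N) Hv). pose proof (poch_neq0 _ (S N) half_notZ0neg).
  pose proof (notZ0neg_neq0 v Hv). pose proof (Cfact_neq0 N).
  assert (Cnpow N (v - Cone) <> Czero) by apply Cexp_neq0.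
  assert (Cnpow N (Cone / RtoC 2) <> Czero) by apply Cexp_neq0.
  assert (Hs : (INC N + RtoC 3 / RtoC 2)%Cx <> Czero).
  { rewrite <- RtoC_div, <- RtoC_add by lra. apply RtoC_neq0. pose proof (pos_INR N). lra. }
  set (s := (INC N + RtoC 3 / RtoC 2)%Cx) in *.
  set (B := Cprod _ (S (S N))) in *.
  set (p := poch v (S N)) in *. set (q := poch _ (S N)) in *.
  set (e := Cnpow N (v - Cone)) in *. set (e' := Cnpow _ _) in *. set (F := Cfact N) in *.
  field. repeat split; assumption.
Qed.

Lemma cos_factor_prod_neq0 (z : Cx) (M : nat) :
  Ccos (z * RtoC PI) <> Czero -> Cprod (cos_factor z) M <> Czero.
Proof.
  intros Hz. apply Cprod_neq0. intros k _ E. apply Hz. destruct z as [x y].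
  rewrite (Ccos_partial_product x y k). simpl Cprod. rewrite E. ring.
Qed.

(** Bounded by 1/(1 - e ln n), again from exp u >= 1 + u. *)
Lemma is_lim_seq_pow_neg (e : R) : e < 0 -> is_lim_seq (fun n => exp (e * ln (INR n))) 0.
Proof.
  intros He.
  assert (Hd : is_lim_seq (fun n => 1 + (- e) * ln (INR n)) p_infty).
  { apply is_lim_seq_spec. intros M. destruct (INR_unbounded (exp (Rabs M / (- e)))) as [N HN].
    exists N. intros n Hn.
    assert (Hln : Rabs M / (- e) < ln (INR n)).
    { rewrite <- (ln_exp (Rabs M / - e)). apply ln_increasing; [apply exp_pos|].
      eapply Rlt_le_trans; [exact HN|]. now apply le_INR. }
    apply (Rmult_lt_compat_l (- e)) in Hln; [|lra].
    replace (- e * (Rabs M / - e)) with (Rabs M) in Hln by (field; lra).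
    pose proof (Rle_abs M). lra. }
  apply (is_lim_seq_inv _ p_infty) in Hd; [|discriminate]. simpl in Hd.
  apply is_lim_seq_le_le_loc with (fun _ => 0) (fun n => / (1 + (- e) * ln (INR n))).
  - exists 1%nat. intros n Hn. split; [left; apply exp_pos|].
    assert (0 <= ln (INR n)).
    { rewrite <- ln_1. apply ln_le; [lra|]. now apply (le_INR 1). }
    replace (exp (e * ln (INR n))) with (/ exp ((- e) * ln (INR n)))
      by (rewrite <- exp_Ropp; f_equal; ring).
    apply Rinv_le_contravar; [nra|]. apply exp_ineq1_le.
  - apply is_lim_seq_const.
  - exact Hd.
Qed.

Lemma Cnorm_Cnpow (n : nat) (z : Cx) : Cnorm (Cnpow n z) = exp (Re z * ln (INR n)).
Proof. unfold Cnpow. rewrite Cnorm_Cexp. f_equal. simpl. ring. Qed.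

Lemma exp_ln_sqr (n : nat) : (1 <= n)%nat -> INR n ^ 2 = exp (2 * ln (INR n)).
Proof.
  intros Hn. assert (0 < INR n) by (apply lt_0_INR; lia).
  replace (2 * ln (INR n)) with (ln (INR n) + ln (INR n)) by ring.
  rewrite exp_plus, exp_ln by assumption. ring.
Qed.

Lemma Cnpow_decay_cv (v : Cx) : Re v < 3 ->
  Cseq_cv (fun N => Cnpow N (v - Cone) / ((INC N + RtoC 3 / RtoC 2) * (INC N + RtoC 3 / RtoC 2)))%Cx Czero.
Proof.
  intros Hv. apply (Cseq_cv_squeeze _ _ (fun n => exp ((Re v - 3) * ln (INR n)))).
  - exists 1%nat. intros n Hn.
    replace (_ - Czero)%Cx with (Cnpow n (v - Cone) / ((INC n + RtoC 3 / RtoC 2) * (INC n + RtoC 3 / RtoC 2)))%Cx by ring.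
    assert (0 < INR n) by (apply lt_0_INR; lia).
    rewrite <- RtoC_div, <- RtoC_add, <- RtoC_mul by lra.
    rewrite Cnorm_div by (apply RtoC_neq0; nra).
    rewrite Cnorm_Cnpow, Cnorm_RtoC, Rabs_right by nra.
    replace (Re (v - Cone)) with (Re v - 1) by (simpl; ring).
    apply Rmult_le_reg_r with ((INR n + 3 / 2) * (INR n + 3 / 2)); [nra|].
    unfold Rdiv at 1. rewrite Rmult_assoc, Rinv_l, Rmult_1_r by nra.
    replace (exp ((Re v - 1) * ln (INR n))) with (exp ((Re v - 3) * ln (INR n)) * INR n ^ 2)
      by (rewrite exp_ln_sqr, <- exp_plus by assumption; f_equal; ring).
    apply Rmult_le_compat_l; [left; apply exp_pos|nra].
  - apply is_lim_seq_pow_neg. lra.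
Qed.

Lemma Csum_diff_bound (f : nat -> Cx) (a : nat -> R) (n0 N : nat) :
  (n0 <= N)%nat -> (forall n, (n <= N)%nat -> Cnorm (f n) <= a n) ->
  Cnorm (Csum f N - Csum f n0) <= sum_n a N - sum_n a n0.
Proof.
  induction N as [|N IH]; intros Hn Hf.
  - replace n0 with 0%nat by lia.
    replace (Csum f 0 - Csum f 0)%Cx with Czero by ring. rewrite Cnorm_zero. lra.
  - destruct (Nat.eq_dec n0 (S N)) as [->|Hne].
    + replace (Csum f (S N) - Csum f (S N))%Cx with Czero by ring. rewrite Cnorm_zero. lra.
    + rewrite sum_Sn. unfold plus; simpl.
      replace (Csum f N + f (S N) - Csum f n0)%Cx with ((Csum f N - Csum f n0) + f (S N))%Cx by ring.
      eapply Rle_trans; [apply Cnorm_triang|].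
      specialize (IH ltac:(lia) ltac:(intros; apply Hf; lia)). specialize (Hf (S N) ltac:(lia)). lra.
Qed.

Lemma Csum_cv_zero (f : nat -> nat -> Cx) (n0 : nat) :
  (forall n, Cseq_cv (fun N => f N n) Czero) -> Cseq_cv (fun N => Csum (f N) n0) Czero.
Proof.
  intros Hf. induction n0 as [|n0 IH]; simpl; [apply Hf|].
  replace Czero with (Czero + Czero)%Cx by ring. now apply Cseq_cv_add.
Qed.

(** Dominated convergence read backwards: the weighted sums are the ones known in closed form, and
    their limit is transferred to the series without weights. The difference of the two is cut at an
    index beyond which the series of norms has a small tail. *)
Lemma tannery (u : nat -> Cx) (w : nat -> nat -> Cx) (B : R) (N0 : nat) (l : Cx) :
  ex_series (fun n => Cnorm (u n)) ->
  (forall N n, (N0 <= N)%nat -> (n <= N)%nat -> Cnorm (w N n) <= B) ->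
  (forall n, Cseq_cv (fun N => w N n) Cone) ->
  Cseq_cv (fun N => Csum (fun n => w N n * u n)%Cx N) l -> Cseq_cv (Csum u) l.
Proof.
  intros [S HS] HB Hw Hl.
  assert (HB0 : 0 <= B) by (eapply Rle_trans; [apply Cnorm_ge0|apply (HB N0 0%nat); lia]).
  assert (HS' : is_lim_seq (sum_n (fun n => Cnorm (u n))) S) by exact HS.
  assert (Hle : forall n, sum_n (fun n => Cnorm (u n)) n <= S).
  { intros n. apply (is_lim_seq_incr_compare (sum_n (fun n => Cnorm (u n))) S HS').
    intros k. rewrite sum_Sn. unfold plus; simpl. pose proof (Cnorm_ge0 (u (Datatypes.S k))). lra. }
  set (f := fun N n => ((Cone - w N n) * u n)%Cx).
  assert (Hf : Cseq_cv (fun N => Csum (f N) N) Czero).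
  { intros eps Heps.
    (* 1 - w has norm at most B + 1, so a tail below [d] costs eps/2; the other half is for the
       finitely many first terms. *)
    set (d := eps / (2 * (B + 1))).
    assert (Hd : 0 < d) by (apply Rdiv_lt_0_compat; lra).
    apply is_lim_seq_spec in HS'. destruct (HS' (mkposreal d Hd)) as [n0 Hn0].
    specialize (Hn0 n0 (le_n _)). simpl in Hn0.
    assert (Hfin : Cseq_cv (fun N => Csum (f N) n0) Czero).
    { apply Csum_cv_zero. intros n. unfold f.
      replace Czero with ((Cone - Cone) * u n)%Cx by ring.
      apply Cseq_cv_mul; [apply Cseq_cv_sub|]; auto using Cseq_cv_const. }
    destruct (Hfin (eps / 2) ltac:(lra)) as [N1 HN1].
    exists (max N0 (max n0 N1)). intros N HN.
    specialize (HN1 N ltac:(lia)).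
    replace (Csum (f N) N - Czero)%Cx with
      ((Csum (f N) N - Csum (f N) n0) + (Csum (f N) n0 - Czero))%Cx by ring.
    eapply Rle_lt_trans; [apply Cnorm_triang|].
    assert (Hbd : Cnorm (Csum (f N) N - Csum (f N) n0) <=
      sum_n (fun n => scal (B + 1) (Cnorm (u n))) N - sum_n (fun n => scal (B + 1) (Cnorm (u n))) n0).
    { apply Csum_diff_bound; [lia|]. intros n Hn. unfold f. rewrite Cnorm_mul.
      apply Rmult_le_compat_r; [apply Cnorm_ge0|].
      eapply Rle_trans; [apply Cnorm_sub_le|]. rewrite Cnorm_Cone.
      specialize (HB N n ltac:(lia) Hn). lra. }
    rewrite !sum_n_scal_l in Hbd. unfold scal in Hbd; simpl in Hbd; unfold mult in Hbd; simpl in Hbd.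
    specialize (Hle N). apply Rabs_def2 in Hn0.
    assert ((B + 1) * (sum_n (fun n => Cnorm (u n)) N - sum_n (fun n => Cnorm (u n)) n0) <= (B + 1) * d)
      by (apply Rmult_le_compat_l; lra).
    assert ((B + 1) * d = eps / 2) by (unfold d; field; lra).
    rewrite <- Rmult_minus_distr_l in Hbd. pose proof (Rle_trans _ _ _ Hbd H). lra. }
  replace l with (l + Czero)%Cx by ring.
  eapply Cseq_cv_ext; [|apply (Cseq_cv_add _ _ _ _ Hl Hf)].
  intros N. cbv beta. rewrite <- Csum_add. apply Csum_ext. intros n _. unfold f. ring.
Qed.

Lemma Cnorm_add_INC_lower (z : Cx) (n : nat) : INR n - Cnorm z <= Cnorm (INC n + z).
Proof.
  pose proof (Cnorm_triang_inv (INC n) (- z)) as H. rewrite Cnorm_opp, Cnorm_INC in H.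
  replace (INC n - - z)%Cx with (INC n + z)%Cx in H by ring. exact H.
Qed.

Lemma inv_add_INC_cv (k z : Cx) : Cseq_cv (fun n => k / (INC n + z))%Cx Czero.
Proof.
  destruct (INR_unbounded (2 * Cnorm z)) as [N HN].
  apply (Cseq_cv_squeeze _ _ (fun n => 2 * Cnorm k * / INR n)).
  - exists (S N). intros n Hn.
    assert (Hn0 : 0 < INR n) by (apply lt_0_INR; lia).
    assert (INR N <= INR n) by (apply le_INR; lia).
    pose proof (Cnorm_add_INC_lower z n) as Hl. pose proof (Cnorm_ge0 z).
    assert (Hnz : (INC n + z)%Cx <> Czero) by (intros E; rewrite E, Cnorm_zero in Hl; lra).
    replace (k / (INC n + z) - Czero)%Cx with (k / (INC n + z))%Cx by ring.
    rewrite Cnorm_div by assumption.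
    apply Rle_trans with (Cnorm k * / (INR n / 2)).
    + apply Rmult_le_compat_l; [apply Cnorm_ge0|]. apply Rinv_le_contravar; lra.
    + right. field. lra.
  - replace (Finite 0) with (Finite (2 * Cnorm k * 0)) by (f_equal; ring).
    apply is_lim_seq_mult'; [apply is_lim_seq_const|].
    apply (is_lim_seq_inv _ p_infty); [apply is_lim_seq_INR|discriminate].
Qed.

Lemma weight_factor_cv (v : Cx) (j : nat) : notZ0neg v -> Re v < 3 ->
  Cseq_cv (fun N => weight_factor v N j) Cone.
Proof.
  (* Shifting N by [j] makes the truncated subtraction N - j exact. *)
  intros Hv Hv3. apply (Cseq_cv_incr_n _ j).
  replace Cone with ((Cone + Czero) * (Cone - Czero))%Cx by ring.
  pose proof (inv_add_INC_cv ((RtoC 3 - v) / RtoC 2) v) as H1.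
  apply (Cseq_cv_incr_n _ (j + j + 1)) in H1.
  pose proof (inv_add_INC_cv ((RtoC 3 - v) / RtoC 2) ((RtoC 3 - v) / RtoC 2)) as H2.
  eapply Cseq_cv_ext; [|apply Cseq_cv_mul;
    [apply Cseq_cv_add; [apply Cseq_cv_const|exact H1]
    |apply Cseq_cv_sub; [apply Cseq_cv_const|exact H2]]].
  intros N. cbv beta. unfold weight_factor.
  replace (N + j - j)%nat with N by lia. replace (N + j + j + 1)%nat with (N + (j + j + 1))%nat by lia.
  pose proof (add_INC_neq0 v (N + (j + j + 1)) Hv) as Z1.
  pose proof (add_nat_half_neq0 v N Hv3) as Z2.
  set (m := INC (N + (j + j + 1))) in *.
  field. repeat split; neq0_scaled.
Qed.

Lemma weight_cv (v : Cx) (n : nat) : notZ0neg v -> Re v < 3 ->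
  Cseq_cv (fun N => weight v N n) Cone.
Proof.
  intros Hv Hv3. unfold weight. induction n as [|n IH]; simpl; [apply Cseq_cv_const|].
  replace Cone with (Cone * Cone)%Cx by ring. apply Cseq_cv_mul; [exact IH|now apply weight_factor_cv].
Qed.

(** Re v < 3 makes Re k positive, so the second part of each factor has norm at most 1. The first is
    at most 1 + 2|k|/N once N >= 2|v|, and a product of n <= N of these stays below exp(2|k|). *)
Lemma weight_bounded (v : Cx) : notZ0neg v -> Re v < 3 ->
  exists B N0, forall N n, (N0 <= N)%nat -> (n <= N)%nat -> Cnorm (weight v N n) <= B.
Proof.
  intros Hv Hv3. set (k := ((RtoC 3 - v) / RtoC 2)%Cx).
  destruct (INR_unbounded (2 * Cnorm v)) as [N1 HN1].
  exists (exp (2 * Cnorm k)), (S N1). intros N n HN Hn.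
  assert (HN0 : 0 < INR N) by (apply lt_0_INR; lia).
  assert (HN1' : INR N1 <= INR N) by (apply le_INR; lia).
  pose proof (Cnorm_ge0 k) as Hk0. pose proof (Cnorm_ge0 v) as Hv0.
  assert (Hfac : forall j, Cnorm (weight_factor v N j) <= exp (2 * Cnorm k / INR N)).
  { intros j. unfold weight_factor. fold k.
    pose proof (add_INC_neq0 v (N + j + 1) Hv) as Z1.
    pose proof (add_nat_half_neq0 v (N - j) Hv3) as Z2. fold k in Z2.
    rewrite Cnorm_mul, (Cnorm_div (INC (N - j))) by assumption.
    assert (Hm : INR N <= INR (N + j + 1)) by (apply le_INR; lia).
    set (m := INC (N + j + 1)) in *.
    replace ((m + v / RtoC 2 + RtoC 3 / RtoC 2) / (m + v))%Cx with (Cone + k / (m + v))%Cx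
      by (unfold k; field; neq0_scaled).
    assert (A1 : Cnorm (Cone + k / (m + v)) <= 1 + 2 * Cnorm k / INR N).
    { eapply Rle_trans; [apply Cnorm_triang|]. rewrite Cnorm_Cone. apply Rplus_le_compat_l.
      replace (m + v)%Cx with (v + m)%Cx by ring.
      rewrite Cnorm_div by assumption.
      pose proof (Cnorm_add_INC_lower v (N + j + 1)) as Hl. fold m in Hl.
      replace (m + v)%Cx with (v + m)%Cx in Hl by ring.
      apply Rle_trans with (Cnorm k * / (INR N / 2)).
      - apply Rmult_le_compat_l; [assumption|]. apply Rinv_le_contravar; lra.
      - right. field. lra. }
    assert (A2 : Cnorm (INC (N - j)) / Cnorm (INC (N - j) + k) <= 1).
    { pose proof (Cnorm_pos _ Z2) as Hp.
      apply Rmult_le_reg_r with (Cnorm (INC (N - j) + k)); [assumption|].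
      unfold Rdiv. rewrite Rmult_assoc, Rinv_l, Rmult_1_r, Rmult_1_l by lra.
      eapply Rle_trans; [|apply Re_le_Cnorm]. rewrite Cnorm_INC.
      eapply Rle_trans; [|apply Rle_abs].
      replace (Re (INC (N - j) + k)) with (INR (N - j) + (3 - Re v) / 2) by (simpl; field). lra. }
    assert (A3 : 0 <= Cnorm (INC (N - j)) / Cnorm (INC (N - j) + k)).
    { apply Rmult_le_pos; [apply Cnorm_ge0|]. left. apply Rinv_0_lt_compat, Cnorm_pos, Z2. }
    pose proof (Cnorm_ge0 (Cone + k / (m + v))) as A4.
    pose proof (exp_ineq1_le (2 * Cnorm k / INR N)) as A5.
    apply Rle_trans with ((1 + 2 * Cnorm k / INR N) * 1); [apply Rmult_le_compat; assumption|lra]. }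
  assert (Hpow : forall i, Cnorm (weight v N i) <= exp (2 * Cnorm k / INR N * INR i)).
  { induction i as [|i IH].
    - change (weight v N 0) with Cone. change (INR 0) with 0. rewrite Rmult_0_r, exp_0, Cnorm_Cone. lra.
    - change (weight v N (S i)) with (weight v N i * weight_factor v N i)%Cx.
      rewrite Cnorm_mul, S_INR, Rmult_plus_distr_l, Rmult_1_r, exp_plus.
      apply Rmult_le_compat; auto using Cnorm_ge0. }
  eapply Rle_trans; [apply Hpow|].
  assert (Hle : 2 * Cnorm k / INR N * INR n <= 2 * Cnorm k).
  { apply Rle_trans with (2 * Cnorm k / INR N * INR N).
    - apply Rmult_le_compat_l; [|now apply le_INR]. apply Rmult_le_pos; [lra|]. left; now apply Rinv_0_lt_compat.
    - right. field. lra. }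
  destruct Hle as [Hle|Hle]; [left; now apply exp_increasing|right; now rewrite Hle].
Qed.

(** * The series *)

Definition summand (v al be : Cx) (n : nat) : Cx :=
  (coef v n / ((node v n - al * al) * (node v n - be * be)))%Cx.

Lemma coef_bound (v : Cx) : notZ0neg v ->
  exists C N0, forall n, (N0 <= n)%nat -> Cnorm (coef v n) <= C * exp (Re v * ln (INR n)).
Proof.
  intros Hv. pose proof (notZ0neg_neq0 v Hv) as Hv0.
  pose proof (Cseq_cv_inv _ _ (CGamma_neq0 v Hv) (CGamma_correct v Hv)) as Hg.
  destruct (Cseq_cv_bounded _ _ Hg) as [N1 HN1]. cbv beta in HN1.
  set (G := Cnorm (/ CGamma v) + 1) in *.
  destruct (INR_unbounded (2 * Cnorm v)) as [N2 HN2].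
  (* For n >= 2|v| one has |v + 2n| <= 5n/2 and |v + n| >= n/2, hence the 5; [G] bounds the
     reciprocals of Gauss' sequence. *)
  exists (5 / Cnorm v * G), (max N1 (S N2)). intros n Hn.
  assert (Hn0 : 0 < INR n) by (apply lt_0_INR; lia).
  assert (HnN : INR N2 <= INR n) by (apply le_INR; lia).
  specialize (HN1 n ltac:(lia)).
  pose proof (poch_neq0 v (S n) Hv) as Hp. pose proof (add_INC_neq0 v n Hv) as Hvn.
  pose proof (Cfact_neq0 n) as Hf.
  assert (Hc : Cnpow n v <> Czero) by apply Cexp_neq0.
  assert (E : coef v n = ((v + RtoC 2 * INC n) / (v + INC n) / v * (/ gauss_seq v n) * Cnpow n v)%Cx).
  { unfold coef, gauss_seq.
    change (poch v (S n)) with (poch v n * (v + INC n))%Cx in *.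
    assert (poch v n <> Czero) by now apply poch_neq0.
    field. repeat split; assumption. }
  pose proof (Cnorm_pos v Hv0) as Hvp. pose proof (Cnorm_pos _ Hvn) as Hvnp.
  rewrite E, !Cnorm_mul, Cnorm_Cnpow.
  apply Rmult_le_compat_r; [left; apply exp_pos|].
  apply Rmult_le_compat; try apply Cnorm_ge0; [|assumption].
  rewrite (Cnorm_div _ v) by assumption. unfold Rdiv. apply Rmult_le_compat_r; [left; now apply Rinv_0_lt_compat|].
  rewrite Cnorm_div by assumption.
  apply Rmult_le_reg_r with (Cnorm (v + INC n)); [assumption|].
  unfold Rdiv. rewrite Rmult_assoc, Rinv_l, Rmult_1_r by lra.
  eapply Rle_trans; [apply Cnorm_triang|]. rewrite Cnorm_mul, Cnorm_INC, Cnorm_RtoC, Rabs_right by lra.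
  pose proof (Cnorm_add_INC_lower v n) as Hl. replace (INC n + v)%Cx with (v + INC n)%Cx in Hl by ring.
  lra.
Qed.

Lemma inv_node_sub_bound (v z : Cx) :
  notZ0neg (v / RtoC 2 - z) -> notZ0neg (v / RtoC 2 + z) ->
  exists N0, forall n, (N0 <= n)%nat -> Cnorm (/ (node v n - z * z)) <= 4 * exp (-2 * ln (INR n)).
Proof.
  intros H1 H2.
  destruct (INR_unbounded (2 * Cnorm (v / RtoC 2 - z))) as [N1 HN1].
  destruct (INR_unbounded (2 * Cnorm (v / RtoC 2 + z))) as [N2 HN2].
  exists (S (N1 + N2)). intros n Hn.
  assert (Hn0 : 0 < INR n) by (apply lt_0_INR; lia).
  assert (INR N1 <= INR n) by (apply le_INR; lia).
  assert (INR N2 <= INR n) by (apply le_INR; lia).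
  rewrite node_sub_sqr.
  pose proof (add_INC_neq0 _ n H1) as Z1. pose proof (add_INC_neq0 _ n H2) as Z2.
  rewrite Cnorm_inv by now apply Cmul_neq0. rewrite Cnorm_mul.
  pose proof (Cnorm_add_INC_lower (v / RtoC 2 - z) n) as L1.
  pose proof (Cnorm_add_INC_lower (v / RtoC 2 + z) n) as L2.
  replace (INC n + (v / RtoC 2 - z))%Cx with (v / RtoC 2 - z + INC n)%Cx in L1 by ring.
  replace (INC n + (v / RtoC 2 + z))%Cx with (v / RtoC 2 + z + INC n)%Cx in L2 by ring.
  replace (-2 * ln (INR n)) with (- (2 * ln (INR n))) by ring.
  rewrite exp_Ropp, <- exp_ln_sqr by lia.
  apply Rle_trans with (/ (INR n / 2 * (INR n / 2))).
  - apply Rinv_le_contravar; [nra|]. apply Rmult_le_compat; lra.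
  - right. field. lra.
Qed.

(** The coefficient is O(n^(Re v)) and each of the two denominators contributes 4/n^2, which gives
    16 and the exponent Re v - 4 = -(1 + (3 - Re v)). *)
Lemma summand_abs_summable (v al be : Cx) : notZ0neg v -> Re v < 3 ->
  notZ0neg (v / RtoC 2 - al) -> notZ0neg (v / RtoC 2 + al) ->
  notZ0neg (v / RtoC 2 - be) -> notZ0neg (v / RtoC 2 + be) ->
  ex_series (fun n => Cnorm (summand v al be n)).
Proof.
  intros Hv Hv3 A1 A2 B1 B2.
  destruct (coef_bound v Hv) as (C & N1 & HC).
  destruct (inv_node_sub_bound v al A1 A2) as [N2 HA].
  destruct (inv_node_sub_bound v be B1 B2) as [N3 HB].
  set (N := (N1 + N2 + N3)%nat).
  apply (ex_series_incr_n _ (S N)).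
  apply (@ex_series_le R_AbsRing R_CompleteNormedModule) with
    (fun k => (16 * C) * Rpower (INR (S (N + k))) (- (1 + (3 - Re v)))).
  - intros k. change norm with Rabs. rewrite Rabs_right by (apply Rle_ge, Cnorm_ge0).
    replace (S N + k)%nat with (S (N + k)) by lia. set (n := S (N + k)).
    specialize (HC n ltac:(unfold n, N; lia)). specialize (HA n ltac:(unfold n, N; lia)).
    specialize (HB n ltac:(unfold n, N; lia)).
    unfold summand. 
    assert (Za : (node v n - al * al)%Cx <> Czero) by (rewrite node_sub_sqr; apply Cmul_neq0; now apply add_INC_neq0).
    assert (Zb : (node v n - be * be)%Cx <> Czero) by (rewrite node_sub_sqr; apply Cmul_neq0; now apply add_INC_neq0).
    replace (coef v n / ((node v n - al * al) * (node v n - be * be)))%Cx with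
      (coef v n * (/ (node v n - al * al) * / (node v n - be * be)))%Cx by (field; split; assumption).
    rewrite !Cnorm_mul.
    apply Rle_trans with (C * exp (Re v * ln (INR n)) * (4 * exp (-2 * ln (INR n)) * (4 * exp (-2 * ln (INR n))))).
    + repeat (apply Rmult_le_compat; auto using Cnorm_ge0; try (apply Rmult_le_pos; apply Cnorm_ge0)).
    + right. unfold Rpower.
      replace (- (1 + (3 - Re v)) * ln (INR n)) with (Re v * ln (INR n) + (-2 * ln (INR n) + -2 * ln (INR n))) by ring.
      rewrite !exp_plus. ring.
  - apply (ex_series_scal_l (16 * C) (fun k => Rpower (INR (S (N + k))) (- (1 + (3 - Re v))))).
    apply (ex_series_incr_n (fun n => Rpower (INR (S n)) (- (1 + (3 - Re v)))) N).
    apply ex_series_Rpower. lra.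
Qed.

(** v = -2m is excluded by the condition on v/2, and v = -(2m+1) would make the factor of index m of
    the cosine product vanish. *)
Lemma notZ0neg_of_half (v : Cx) : notZ0neg (v / RtoC 2) ->
  Ccos (v / RtoC 2 * RtoC PI) <> Czero -> notZ0neg v.
Proof.
  intros Hv2 Hc k E. destruct (Nat.Even_or_Odd k) as [[m Hm]|[m Hm]]; subst k.
  - apply (Hv2 m). rewrite E, mult_INR, !RtoC_opp, RtoC_mul. change (INR 2) with 2. field.
  - apply (cos_factor_prod_neq0 _ (S m) Hc). simpl Cprod.
    assert (E0 : cos_factor (v / RtoC 2) m = Czero).
    { pose proof (half_shift_neq0 m) as Hh. unfold cos_factor.
      replace (v / RtoC 2)%Cx with (- (INC m + Cone / RtoC 2))%Cx.
      - set (h := (INC m + Cone / RtoC 2)%Cx) in *. field. exact Hh.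
      - rewrite E, plus_INR, mult_INR, RtoC_opp, RtoC_add, RtoC_mul. change (INR 2) with 2. change (INC 1) with Cone. field. }
    rewrite E0. ring.
Qed.

Lemma residue0_neq0 (v : Cx) (N : nat) : notZ0neg v ->
  Ccos (v / RtoC 2 * RtoC PI) <> Czero -> residue v N 0 <> Czero.
Proof.
  intros Hv Hc. rewrite residue0_eq, Cprod_half_sqr by assumption.
  apply Cdiv_neq0; apply Cmul_neq0;
    auto using notZ0neg_neq0, Cfact_neq0, (poch_neq0 v (S N) Hv).
  apply Cmul_neq0; [|now apply cos_factor_prod_neq0].
  apply Cmul_neq0; apply poch_neq0, half_notZ0neg.
Qed.

Lemma inv_residue0_cv (v : Cx) : notZ0neg v -> Re v < 3 ->
  Ccos (v / RtoC 2 * RtoC PI) <> Czero -> Cseq_cv (fun N => / residue v N 0)%Cx Czero.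
Proof.
  intros Hv Hv3 Hc.
  pose proof (CGamma_neq0 v Hv) as Hg. pose proof (notZ0neg_neq0 v Hv) as Hv0.
  pose proof (Ccos_product_cv (v / RtoC 2)) as HE. apply (Cseq_cv_incr_n _ 2) in HE.
  eapply Cseq_cv_ext; [intros N; symmetry; apply inv_residue0_eq; auto using cos_factor_prod_neq0|].
  replace Czero with (Czero * (CGamma (Cone / RtoC 2) * CGamma (Cone / RtoC 2) /
    (CGamma v * Ccos (v / RtoC 2 * RtoC PI) * v)))%Cx by (field; auto).
  apply Cseq_cv_mul; [now apply Cnpow_decay_cv|].
  pose proof (CGamma_correct _ half_notZ0neg).
  apply Cseq_cv_div; [apply Cmul_neq0; [apply Cmul_neq0|]; assumption| |].
  - now apply Cseq_cv_mul.
  - apply Cseq_cv_mul; [|apply Cseq_cv_const]. apply Cseq_cv_mul; [now apply CGamma_correct|].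
    eapply Cseq_cv_ext; [|exact HE]. intros n; cbv beta. f_equal. lia.
Qed.

Lemma quotient_ratio_cv (v z : Cx) : notZ0neg v ->
  Ccos (v / RtoC 2 * RtoC PI) <> Czero ->
  notZ0neg (v / RtoC 2 - z) -> notZ0neg (v / RtoC 2 + z) ->
  Cseq_cv (fun N => pf_quotient half_sqr (node v) N (z * z) / residue v N 0)%Cx
   (Ccos (z * RtoC PI) / Ccos (v / RtoC 2 * RtoC PI) *
     (CGamma (v / RtoC 2 - z) * CGamma (v / RtoC 2 + z) / (CGamma v * v)))%Cx.
Proof.
  intros Hv Hc H1 H2.
  pose proof (CGamma_neq0 v Hv) as Hg. pose proof (notZ0neg_neq0 v Hv) as Hv0.
  assert (HE : forall w, Cseq_cv (fun N => Cprod (cos_factor w) (S (S N))) (Ccos (w * RtoC PI))).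
  { intros w. pose proof (Ccos_product_cv w) as HE. apply (Cseq_cv_incr_n _ 2) in HE.
    eapply Cseq_cv_ext; [|exact HE]. intros n; cbv beta. f_equal. lia. }
  eapply Cseq_cv_ext; [intros N; symmetry; apply quotient_ratio_eq; auto using cos_factor_prod_neq0|].
  apply Cseq_cv_mul; [now apply Cseq_cv_div|].
  apply Cseq_cv_div; [now apply Cmul_neq0| |]; apply Cseq_cv_mul; auto using CGamma_correct, Cseq_cv_const.
Qed.

Theorem summand_series (v al be : Cx) : notZ0neg v -> Re v < 3 ->
  Ccos (v / RtoC 2 * RtoC PI) <> Czero ->
  notZ0neg (v / RtoC 2 - al) -> notZ0neg (v / RtoC 2 + al) ->
  notZ0neg (v / RtoC 2 - be) -> notZ0neg (v / RtoC 2 + be) ->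
  (al * al - be * be)%Cx <> Czero ->
  Cseq_cv (Csum (summand v al be))
   ((Ccos (al * RtoC PI) / Ccos (v / RtoC 2 * RtoC PI) *
       (CGamma (v / RtoC 2 - al) * CGamma (v / RtoC 2 + al) / (CGamma v * v)) -
     Ccos (be * RtoC PI) / Ccos (v / RtoC 2 * RtoC PI) *
       (CGamma (v / RtoC 2 - be) * CGamma (v / RtoC 2 + be) / (CGamma v * v))) / (al * al - be * be))%Cx.
Proof.
  intros Hv Hv3 Hc A1 A2 B1 B2 Hab.
  assert (Hnode : forall z, notZ0neg (v / RtoC 2 - z) -> notZ0neg (v / RtoC 2 + z) ->
    forall n, (node v n - z * z)%Cx <> Czero).
  { intros z H1 H2 n. rewrite node_sub_sqr. apply Cmul_neq0; now apply add_INC_neq0. }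
  destruct (weight_bounded v Hv Hv3) as (B & N0 & HB).
  apply (tannery _ (weight v) B N0).
  - now apply summand_abs_summable.
  - exact HB.
  - intros n. now apply weight_cv.
  - eapply Cseq_cv_ext; [intros N; symmetry; unfold summand; apply weighted_sum_eq; auto using residue0_neq0|].
    match goal with |- Cseq_cv _ ?l => replace l with (l + Czero)%Cx by ring end.
    apply Cseq_cv_add; [|now apply inv_residue0_cv].
    apply Cseq_cv_div; [assumption| |apply Cseq_cv_const].
    apply Cseq_cv_sub; now apply quotient_ratio_cv.
Qed.

(** * From the summand to the hypergeometric series *)

Lemma poch_Cone_add (z : Cx) (n : nat) : (poch (Cone + z) n * z)%Cx = (poch z n * (z + INC n))%Cx.
Proof.
  induction n as [|n IH].
  - simpl. change (RtoC 0) with Czero. ring.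
  - simpl poch. rewrite INC_S.
    transitivity ((poch (Cone + z) n * z) * (Cone + z + INC n))%Cx; [ring|]. rewrite IH. ring.
Qed.

Lemma notZ0neg_pred (z : Cx) : z <> Czero -> notZ0neg (Cone + z) -> notZ0neg z.
Proof.
  intros Hz H [|k] E.
  - apply Hz. rewrite E. simpl. now rewrite Ropp_0.
  - apply (H k). rewrite E, !RtoC_opp, INC_S. ring.
Qed.

Lemma Cpow_Cone (n : nat) : Cpow Cone n = Cone.
Proof. induction n as [|n IH]; simpl; [reflexivity|rewrite IH; ring]. Qed.

(** Each pair (s)_n / (1+s)_n collapses to s/(s+n). The denominators pair off as (v/2 - al + n)(v/2
    + al + n) = (v/2 + n)^2 - al^2, and likewise for be, while (1 + v/2)_n / (v/2)_n collapses to (v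
    + 2n)/v. *)
Lemma hyp_term_eq (v al be : Cx) (n : nat) :
  notZ0neg v -> notZ0neg (v / RtoC 2) ->
  notZ0neg (v / RtoC 2 - al) -> notZ0neg (v / RtoC 2 + al) ->
  notZ0neg (v / RtoC 2 - be) -> notZ0neg (v / RtoC 2 + be) ->
  notZ0neg (Cone + (v / RtoC 2 - al)) -> notZ0neg (Cone + (v / RtoC 2 + al)) ->
  notZ0neg (Cone + (v / RtoC 2 - be)) -> notZ0neg (Cone + (v / RtoC 2 + be)) ->
  hyp_term
    [v; Cone + v / RtoC 2; v / RtoC 2 - al; v / RtoC 2 + al; v / RtoC 2 - be; v / RtoC 2 + be]%Cx
    [v / RtoC 2; Cone + (v / RtoC 2 - al); Cone + (v / RtoC 2 + al);
     Cone + (v / RtoC 2 - be); Cone + (v / RtoC 2 + be)]%Cx Cone n =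
  ((v / RtoC 2 - al) * (v / RtoC 2 + al) * (v / RtoC 2 - be) * (v / RtoC 2 + be) * summand v al be n)%Cx.
Proof.
  intros Hv Hv2 A1 A2 B1 B2 A1' A2' B1' B2'.
  unfold hyp_term, summand, coef. rewrite Cpow_Cone, !node_sub_sqr. simpl poch_prod.
  assert (Hq : forall z, notZ0neg z -> notZ0neg (Cone + z) ->
    (poch z n / poch (Cone + z) n)%Cx = (z / (z + INC n))%Cx).
  { intros z Hz Hz'. pose proof (poch_neq0 _ n Hz'). pose proof (add_INC_neq0 z n Hz).
    transitivity ((poch z n * (z + INC n)) / (poch (Cone + z) n * (z + INC n)))%Cx; [field; auto|].
    rewrite <- poch_Cone_add. field. auto. }
  assert (Hh : (poch (Cone + v / RtoC 2) n / poch (v / RtoC 2) n)%Cx = ((v + RtoC 2 * INC n) / v)%Cx).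
  { pose proof (notZ0neg_neq0 v Hv). pose proof (poch_neq0 _ n Hv2).
    transitivity ((poch (Cone + v / RtoC 2) n * (v / RtoC 2)) * RtoC 2 / (v * poch (v / RtoC 2) n))%Cx; [field; auto|].
    rewrite poch_Cone_add. field. auto. }
  transitivity (poch v n / Cfact n * (poch (Cone + v / RtoC 2) n / poch (v / RtoC 2) n) *
    (poch (v / RtoC 2 - al) n / poch (Cone + (v / RtoC 2 - al)) n) *
    (poch (v / RtoC 2 + al) n / poch (Cone + (v / RtoC 2 + al)) n) *
    (poch (v / RtoC 2 - be) n / poch (Cone + (v / RtoC 2 - be)) n) *
    (poch (v / RtoC 2 + be) n / poch (Cone + (v / RtoC 2 + be)) n))%Cx.
  - pose proof (poch_neq0 _ n Hv2). pose proof (poch_neq0 _ n A1'). pose proof (poch_neq0 _ n A2').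
    pose proof (poch_neq0 _ n B1'). pose proof (poch_neq0 _ n B2'). pose proof (Cfact_neq0 n).
    set (h := (v / RtoC 2)%Cx) in *.
    set (p1 := poch (Cone + (h - al)) n) in *. set (p2 := poch (Cone + (h + al)) n) in *.
    set (p3 := poch (Cone + (h - be)) n) in *. set (p4 := poch (Cone + (h + be)) n) in *.
    set (p5 := poch h n) in *. set (p6 := Cfact n) in *.
    field. repeat split; assumption.
  - rewrite !Hq, Hh by assumption.
    pose proof (add_INC_neq0 _ n A1) as Z1. pose proof (add_INC_neq0 _ n A2) as Z2.
    pose proof (add_INC_neq0 _ n B1) as Z3. pose proof (add_INC_neq0 _ n B2) as Z4.
    pose proof (notZ0neg_neq0 v Hv). pose proof (Cfact_neq0 n).
    set (h := (v / RtoC 2)%Cx) in *. field. repeat split; assumption.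
Qed.

(** [hcos] keeps the divisor cos(pi v/2) nonzero, that is, it excludes the odd integers v. *)
Theorem mainTheorem2 (v a b c : Cx)
  (ha : a <> Czero) (hb : b <> Czero) (hv1 : v <> Cone)
  (hv3 : Re v < 3) (hc : Re c > 0)
  (h1 : Re (Cadd (Cadd (Cmul v c) a) b) > 0)
  (h2 : Re (Csub (Cadd (Cmul v c) a) b) > 0)
  (h3 : Re (Cadd (Csub (Cmul v c) a) b) > 0)
  (h4 : Re (Csub (Csub (Cmul v c) a) b) > 0)
  (hv2 : notZ0neg (Cdiv v (RtoC 2)))
  (hcos : Ccos (Cdiv (Cmul v CPI) (RtoC 2)) <> Czero) :
  let s3 := Csub (Csub (Cdiv v (RtoC 2)) (Cdiv a (Cmul (RtoC 2) c))) (Cdiv b (Cmul (RtoC 2) c)) in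
  let s4 := Cadd (Csub (Cdiv v (RtoC 2)) (Cdiv a (Cmul (RtoC 2) c))) (Cdiv b (Cmul (RtoC 2) c)) in
  let s5 := Cadd (Cadd (Cdiv v (RtoC 2)) (Cdiv a (Cmul (RtoC 2) c))) (Cdiv b (Cmul (RtoC 2) c)) in
  let s6 := Csub (Cadd (Cdiv v (RtoC 2)) (Cdiv a (Cmul (RtoC 2) c))) (Cdiv b (Cmul (RtoC 2) c)) in
  let P := Cmul (Cmul (Cmul (Csub (Csub (Cmul v c) a) b) (Cadd (Cadd (Cmul v c) a) b))
                      (Cadd (Csub (Cmul v c) a) b)) (Csub (Cadd (Cmul v c) a) b) in
  notZ0neg (Cadd Cone s3) -> notZ0neg (Cadd Cone s4) ->
  notZ0neg (Cadd Cone s5) -> notZ0neg (Cadd Cone s6) ->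
  hyp_series_sum
    [v; Cadd Cone (Cdiv v (RtoC 2)); s3; s5; s4; s6]
    [Cdiv v (RtoC 2); Cadd Cone s3; Cadd Cone s5; Cadd Cone s4; Cadd Cone s6]
    Cone
    (Cmul
      (Cdiv P (Cmul (Cmul (Cmul (Cmul (Cmul (RtoC 16) v) a) b) (Cmul c c)) (CGamma v)))
      (Csub
        (Cmul (Cmul (CGamma s5) (CGamma s3))
              (Cdiv (Ccos (Cdiv (Cmul (Cadd a b) CPI) (Cmul (RtoC 2) c)))
                    (Ccos (Cdiv (Cmul v CPI) (RtoC 2)))))
        (Cmul (Cmul (CGamma s6) (CGamma s4))
              (Cdiv (Ccos (Cdiv (Cmul (Csub a b) CPI) (Cmul (RtoC 2) c)))
                    (Ccos (Cdiv (Cmul v CPI) (RtoC 2))))))).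
Proof.
  intros s3 s4 s5 s6 P g3 g4 g5 g6.
  assert (Hc0 : c <> Czero) by now apply neq0_of_Re_pos.
  set (al := ((a + b) / (RtoC 2 * c))%Cx). set (be := ((a - b) / (RtoC 2 * c))%Cx).
  assert (E3 : s3 = (v / RtoC 2 - al)%Cx) by (unfold s3, al; field; assumption).
  assert (E5 : s5 = (v / RtoC 2 + al)%Cx) by (unfold s5, al; field; assumption).
  assert (E4 : s4 = (v / RtoC 2 - be)%Cx) by (unfold s4, be; field; assumption).
  assert (E6 : s6 = (v / RtoC 2 + be)%Cx) by (unfold s6, be; field; assumption).
  (* The numbers vc ± a ± b are 2c times the sigmas. Their positive real parts show that no sigma is
     0, which passes from the condition on 1 + s to the one on s. *)
  assert (Hs : forall s w, 0 < Re w -> w = (RtoC 2 * c * s)%Cx -> notZ0neg (Cone + s) -> notZ0neg s).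
  { intros s w Hw Ew Hs. apply notZ0neg_pred; [|assumption]. intros E.
    apply (neq0_of_Re_pos w Hw). rewrite Ew, E. ring. }
  assert (k3 : notZ0neg s3) by (apply (Hs _ _ h4); [unfold s3; field|]; assumption).
  assert (k4 : notZ0neg s4) by (apply (Hs _ _ h3); [unfold s4; field|]; assumption).
  assert (k5 : notZ0neg s5) by (apply (Hs _ _ h1); [unfold s5; field|]; assumption).
  assert (k6 : notZ0neg s6) by (apply (Hs _ _ h2); [unfold s6; field|]; assumption).
  assert (EP : P = (RtoC 16 * (c * c * (c * c)) * (s3 * s5 * s4 * s6))%Cx)
    by (unfold P, s3, s4, s5, s6; field; assumption).
  assert (Ev : (v * CPI / RtoC 2)%Cx = (v / RtoC 2 * RtoC PI)%Cx) by (unfold CPI; field).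
  assert (Ea : ((a + b) * CPI / (RtoC 2 * c))%Cx = (al * RtoC PI)%Cx) by (unfold al, CPI; field; assumption).
  assert (Eb : ((a - b) * CPI / (RtoC 2 * c))%Cx = (be * RtoC PI)%Cx) by (unfold be, CPI; field; assumption).
  (* Nonzero because a and b are. Together with the c^4 in [EP] it produces the divisor a b c^2 of
     the prefactor. *)
  assert (Eab : (al * al - be * be)%Cx = (a * b / (c * c))%Cx) by (unfold al, be; field; assumption).
  rewrite Ev in *. rewrite Ea, Eb, EP.
  clearbody s3 s4 s5 s6 P al be. subst s3 s4 s5 s6.
  pose proof (notZ0neg_of_half v hv2 hcos) as Hv.
  pose proof (CGamma_neq0 v Hv) as Hg. pose proof (notZ0neg_neq0 v Hv) as Hv0.
  unfold hyp_series_sum.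
  pose proof (summand_series v al be Hv hv3 hcos k3 k5 k4 k6
    ltac:(rewrite Eab; apply Cdiv_neq0; apply Cmul_neq0; assumption)) as HS.
  set (K := ((v / RtoC 2 - al) * (v / RtoC 2 + al) * (v / RtoC 2 - be) * (v / RtoC 2 + be))%Cx).
  eapply Cseq_cv_ext.
  - intros n. symmetry. transitivity (Csum (fun n => K * summand v al be n)%Cx n).
    + apply Csum_ext. intros k _. now apply hyp_term_eq.
    + apply Csum_scal.
  - match goal with |- Cseq_cv _ ?l => match type of HS with Cseq_cv _ ?m => replace l with (K * m)%Cx end end.
    + apply Cseq_cv_mul; [apply Cseq_cv_const|exact HS].
    + rewrite Eab. fold K.
      set (h := (v / RtoC 2)%Cx) in *.
      set (q1 := Ccos (h * RtoC PI)) in *. set (q2 := Ccos (al * RtoC PI)).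
      set (q3 := Ccos (be * RtoC PI)). clearbody K q1 q2 q3.
      set (G1 := CGamma (h - al)). set (G2 := CGamma (h + al)).
      set (G3 := CGamma (h - be)). set (G4 := CGamma (h + be)). set (G := CGamma v) in *.
      field. repeat split; assumption.
Qed.
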